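(* Let $L$ be a line in $\mathbb{K}P^3$ such that $L\cap Q(\mathbb{K})$ consists of exactly two points. Then $\operatorname{VAL}(L)$ is equal to one of the following sets: (iii) $\{r\}\times\sigma(l\setminus\{p,q\})\ \cup\ ((r,\infty)\cap\mathbb{Q})\times\mathcal{S}|_{\{p,q\}}\ \cup\ \{\infty\}\times\{p,q\}$, where $r>0$, $l$ is a line contained in $Q(\mathbb{C})$, $p,q$ are distinct points of $l$, and $\sigma$ is a section of $\mathcal{S}$ over $l\setminus\{p,q\}$; (iv) $\{0\}\times\varkappa^\circ(l\setminus\{p,q\})\ \cup\ ((0,\infty)\cap\mathbb{Q})\times\mathcal{S}|_{\{p,q\}}\ \cup\ \{\infty\}\times\{p,q\}$, where $l$ is a line in $\mathbb{C}P^3$ intersecting $Q(\mathbb{C})$ in two points $p$ and $q$; (i) $\{r\}\times\sigma(l\setminus\{p\})\ \cup\ ((r,\infty)\cap\mathbb{Q})\times\mathcal{S}|_{\{p\}}\ \cup\ \{\infty\}\times\{p\}$, where $r>0$, $l$ is a line contained in $Q(\mathbb{C})$, $p\in l$, and $\sigma$ is a section of $\mathcal{S}$ over $l\setminus\{p\}$; or (ii) $\{0\}\times\varkappa^\circ(l\setminus\{p\})\ \cup\ ((0,\infty)\cap\mathbb{Q})\times\mathcal{S}|_{\{p\}}\ \cup\ \{\infty\}\times\{p\}$, where $l$ is a line in $\mathbb{C}P^3$ tangent to $Q(\mathbb{C})$ at the point $p$.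
   Context: Matrices and classes. For a $2\times 2$ matrix $B=\begin{pmatrix}a&b\\ c&d\end{pmatrix}$ write $B^{\mathbf c}=\begin{pmatrix}d&-b\\ -c&a\end{pmatrix}$; $B^*$ is the conjugate transpose. $\mathbb{C}P^3$ is the projectivization of the space of complex $2\times2$ matrices; $[B]_{\mathbb{C}^*}$ is the class of a nonzero matrix up to nonzero complex scalars, $[B]_{\mathbb{R}^*}$ its class up to nonzero real scalars. $Q(\mathbb{C})=\{[B]_{\mathbb{C}^*}:\det B=0\}$, $PSL_2(\mathbb{C})=\mathbb{C}P^3\setminus Q(\mathbb{C})$, $PSU(2)=\{[U]_{\mathbb{C}^*}:U\in SU(2)\}$. The spherical coamoeba map $\varkappa^\circ\colon PSL_2(\mathbb{C})\to PSU(2)$ sends $[A]_{\mathbb{C}^*}$ with $\det A=1$ to $[A+(A^{\mathbf c})^*]_{\mathbb{R}^*}$ (the class of the unitary factor of the polar decomposition of $A$). Circle bundle. $\mathcal{S}$ is the set of classes $[B]_{\mathbb{R}^*}$ of complex $2\times2$ matrices of rank one, with projection $\pi\colon\mathcal{S}\to Q(\mathbb{C})$, $[B]_{\mathbb{R}^*}\mapsto[B]_{\mathbb{C}^*}$; for $Z\subset Q(\mathbb{C})$, $\mathcal{S}|_Z=\pi^{-1}(Z)$, and a section of $\mathcal{S}$ over $Z$ is a continuous map $\sigma\colon Z\to\mathcal{S}$ with $\pi\circ\sigma=\mathrm{id}_Z$. Cone notation (all sets are subsets of $\mathbb{C}P^3$). For $I\subset(0,\infty)$ and $T\subset\mathcal{S}$,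 $I\times T:=\{[e^\alpha B+e^{-\alpha}(B^{\mathbf c})^*]_{\mathbb{C}^*}:\alpha\in I,\ [B]_{\mathbb{R}^*}\in T\}$; for $X\subset PSU(2)$, $\{0\}\times X:=X$; for $Y\subset Q(\mathbb{C})$, $\{\infty\}\times Y:=Y$. Field and valuation. $\mathbb{K}$ is the field of Puiseux series in $t$ (with $t\to\infty$) with complex coefficients, i.e. series $\sum_q a_q t^q$ with $a_q\in\mathbb{C}$ and exponents in $\frac1N\mathbb{Z}$ for some $N\ge1$, bounded above; it is algebraically closed. $\mathbb{K}P^3$ is the projectivization of the space of $2\times 2$ matrices over $\mathbb{K}$, and $Q(\mathbb{K})\subset\mathbb{K}P^3$ the quadric $\det=0$. Every nonzero matrix $A$ over $\mathbb{K}$ can be written uniquely as $A=t^\alpha B+(\text{terms with exponents}<\alpha)$ with $\alpha\in\mathbb{Q}$ and $B$ a nonzero complex matrix. The map $\operatorname{VAL}\colon\mathbb{K}P^3\to\mathbb{C}P^3$ is: if $\det A=0$, $\operatorname{VAL}([A])=[B]_{\mathbb{C}^*}$; if $\det A\ne0$, rescale $A$ so that $\det A=1$ (then $\alpha\ge0$), and set $\operatorname{VAL}([A])=[e^\alpha B+e^{-\alpha}(B^{\mathbf c})^*]_{\mathbb{C}^*}$. *)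

(* Defs.v *)
From HB Require Import structures.
From mathcomp Require Import all_boot all_order all_algebra.
From mathcomp Require Import classical_sets fsbigop reals sequences exp.
From mathcomp Require Import complex.
Import GRing.Theory Num.Theory.
Local Open Scope ring_scope.
Local Open Scope complex_scope.
Local Open Scope classical_set_scope.

Set Implicit Arguments.
Unset Strict Implicit.
Unset Printing Implicit Defensive.

Section Defs.
Variable R : realType.
Local Notation C := (R[i]).

(* Complex side.  A point of CP^3 (a class [B]_{C^*}) is represented by
   any nonzero complex 2x2 matrix B; a SET of points of CP^3 is
   represented by the (C^*-saturated) set of all its representatives.
   Similarly an element [B]_{R^*} of the circle bundle S is represented
   by its representatives, and subsets of S by R^*-saturated sets.     *)

Definition matc (B : 'M[C]_2) : 'M[C]_2 :=
  \matrix_(i, j) (if i == j then B (rev_ord i) (rev_ord j) else - B i j).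

Definition cstar (B : 'M[C]_2) : 'M[C]_2 := map_mx conjc B^T.

(* same point of CP^3 : V = z B with z in C^* *)
Definition cprop (U V : 'M[C]_2) : Prop := exists z : C, z != 0 /\ V = z *: U.

(* same point of S : V = x B with x in R^* *)
Definition rprop (U V : 'M[C]_2) : Prop :=
  exists x : R, x != 0 /\ V = x%:C *: U.

Definition cline (P1 P2 : 'M[C]_2) : set 'M[C]_2 :=
  [set A | (exists l m : C, A = l *: P1 + m *: P2) /\ A != 0].

Definition cindep (P1 P2 : 'M[C]_2) : Prop :=
  forall l m : C, l *: P1 + m *: P2 = 0 -> l = 0 /\ m = 0.

(* the points of the line other than p and q (take q = p for l \ {p}) *)
Definition punct (P1 P2 p q : 'M[C]_2) : set 'M[C]_2 :=
  [set B | cline P1 P2 B /\ ~ cprop p B /\ ~ cprop q B].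

Definition detpolar (P A : 'M[C]_2) : C := \det (P + A) - \det P - \det A.

Definition mnorm2 (B : 'M[C]_2) : R :=
  \sum_(i < 2) \sum_(j < 2) ((complex.Re (B i j)) ^+ 2 + (complex.Im (B i j)) ^+ 2).

(* Fubini-Study type (squared) distance on CP^3 is < d *)
Definition closeP (d : R) (U V : 'M[C]_2) : Prop :=
  exists z w : C, mnorm2 (z *: U) = 1 /\ mnorm2 (w *: V) = 1 /\
                  mnorm2 (z *: U - w *: V) < d.

(* (squared) quotient distance on S = (rank one matrices)/R^* is < e *)
Definition closeS (e : R) (U V : 'M[C]_2) : Prop :=
  exists x y : R, mnorm2 (x%:C *: U) = 1 /\ mnorm2 (y%:C *: V) = 1 /\
                  mnorm2 (x%:C *: U - y%:C *: V) < e.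

(* s represents a section sigma of S over the (C^*-saturated) set Z
   of points of Q(C): s B represents sigma([B]_{C^*}).  Conditions:
   s B is a rank-one matrix, pi (sigma [B]) = [B], the class of s B
   depends only on [B], and sigma is continuous (for the quotient
   topologies, given by the metrics above). *)
Definition section (s : 'M[C]_2 -> 'M[C]_2) (Z : set 'M[C]_2) : Prop :=
  (forall B, Z B -> s B != 0 /\ \det (s B) = 0 /\ cprop B (s B)) /\
  (forall B z, Z B -> z != 0 -> rprop (s B) (s (z *: B))) /\
  (forall B (e : R), Z B -> 0 < e -> exists d : R, 0 < d /\
     forall B', Z B' -> closeP d B B' -> closeS e (s B) (s B')).

Definition sec_image (s : 'M[C]_2 -> 'M[C]_2) (Z : set 'M[C]_2) :
  set 'M[C]_2 := [set M | exists B, Z B /\ rprop (s B) M].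

Definition Srestr (p q : 'M[C]_2) : set 'M[C]_2 :=
  [set B | B != 0 /\ \det B = 0 /\ (cprop p B \/ cprop q B)].

(* {infty} x {p,q} = {p,q} *)
Definition pts (p q : 'M[C]_2) : set 'M[C]_2 :=
  [set X | cprop p X \/ cprop q X].

(* I x T *)
Definition cone (I : set R) (T : set 'M[C]_2) : set 'M[C]_2 :=
  [set X | exists (a : R) (B : 'M[C]_2), I a /\ T B /\
     cprop ((expR a)%:C *: B + (expR (- a))%:C *: cstar (matc B)) X].

(* {0} x kappa°(Z), Z a subset of PSL_2(C) *)
Definition kappa_image (Z : set 'M[C]_2) : set 'M[C]_2 :=
  [set X | exists A, Z A /\ \det A = 1 /\ cprop (A + cstar (matc A)) X].

Definition ratint (r : R) : set R :=
  [set a | r < a /\ exists q : rat, a = ratr q].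

(* Puiseux series: a series sum_q a_q t^q is its coefficient function
   a : rat -> C; it is a Puiseux series when its exponents lie in
   (1/N)Z for some N >= 1 and are bounded above.                       *)
Definition puiseux (a : rat -> C) : Prop :=
  exists (N : nat) (M : rat), (0 < N)%N /\
    forall q, a q != 0 -> (exists z : int, q = z%:~R / N%:R) /\ q <= M.

Definition kzero : rat -> C := fun _ => 0.
Definition kone : rat -> C := fun q => if q == 0 then 1 else 0.
Definition kadd (a b : rat -> C) : rat -> C := fun q => a q + b q.
Definition kopp (a : rat -> C) : rat -> C := fun q => - a q.
(* Cauchy product (the sum is finite for Puiseux series) *)
Definition kmul (a b : rat -> C) : rat -> C :=
  fun q => \sum_(p \in [set: rat]) a p * b (q - p).

Definition Kmat := 'I_2 -> 'I_2 -> (rat -> C).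

Definition kmat_puiseux (A : Kmat) : Prop := forall i j, puiseux (A i j).
Definition kmat_zero (A : Kmat) : Prop := forall i j, A i j = kzero.

Definition kdet (A : Kmat) : rat -> C :=
  kadd (kmul (A ord0 ord0) (A ord_max ord_max))
       (kopp (kmul (A ord0 ord_max) (A ord_max ord0))).

Definition kscale (c : rat -> C) (A : Kmat) : Kmat :=
  fun i j => kmul c (A i j).

Definition klin (l : rat -> C) (A1 : Kmat) (m : rat -> C) (A2 : Kmat) : Kmat :=
  fun i j => kadd (kmul l (A1 i j)) (kmul m (A2 i j)).

(* same point of KP^3 *)
Definition kprop (A A' : Kmat) : Prop :=
  exists c, puiseux c /\ c <> kzero /\ forall i j, A' i j = kmul c (A i j).

Definition kindep (A1 A2 : Kmat) : Prop :=
  kmat_puiseux A1 /\ kmat_puiseux A2 /\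
  forall l m, puiseux l -> puiseux m ->
    kmat_zero (klin l A1 m A2) -> l = kzero /\ m = kzero.

Definition kline (A1 A2 : Kmat) : set Kmat :=
  [set A | (exists l m, puiseux l /\ puiseux m /\ A = klin l A1 m A2)
           /\ ~ kmat_zero A].

Definition meets_Q_in_two (A1 A2 : Kmat) : Prop :=
  exists P P', kline A1 A2 P /\ kline A1 A2 P' /\
    kdet P = kzero /\ kdet P' = kzero /\ ~ kprop P P' /\
    forall A, kline A1 A2 A -> kdet A = kzero -> kprop P A \/ kprop P' A.

Definition lead_data (A : Kmat) (alpha : rat) (B : 'M[C]_2) : Prop :=
  B != 0 /\ (forall i j, B i j = A i j alpha) /\
  (forall i j q, alpha < q -> A i j q = 0).

Definition val_rel (A : Kmat) (X : 'M[C]_2) : Prop :=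
  (kdet A = kzero /\ exists alpha B, lead_data A alpha B /\ cprop B X) \/
  (kdet A <> kzero /\ exists c alpha B, puiseux c /\
     kmul (kmul c c) (kdet A) = kone /\ lead_data (kscale c A) alpha B /\
     cprop ((expR (ratr alpha))%:C *: B
            + (expR (- ratr alpha))%:C *: cstar (matc B)) X).

Definition VALline (A1 A2 : Kmat) : set 'M[C]_2 :=
  [set X | exists A, kline A1 A2 A /\ val_rel A X].

End Defs.

(* Main.v *)
(** Write the line as spanned by its two points P, P' on the quadric, scaled so
    that the polarized determinant of P and P' is 1.  Off the quadric, a point of
    the line then has a representative l P + l^-1 P' of determinant 1, and VAL is
    read off the leading term of this matrix as l varies.  Rescaling P by g and P'
    by g^-1, both get the same valuation r >= 0; let B, B' be their leading
    matrices.  If B and B' are independent, no cancellation occurs: l of nonzero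
    valuation gives the cone over B or B', and l of valuation 0 gives
    c B + c^-1 B'; this is case (iii) for r > 0 and (iv) for r = 0.  If B' = k B,
    write P' = u P + E with the leading matrix D of E, of valuation s < r,
    independent of B.  Then l P + l^-1 P' = (l + u/l) P + l^-1 E, where l + u/l can
    be small only if l is close to a square root of -u, which Newton's iteration
    provides; so the extremal stratum consists of the x B + c^-1 D with c^2 = -k,
    and det E = -u gives s >= 0, with case (i) for s > 0 and (ii) for s = 0.

    In (iii) and (i) the section divides a matrix by a square root of a quadratic
    form; the two choices of the root give the same class modulo R^*. *)

Require Import Defs.
From HB Require Import structures.
From mathcomp Require Import all_boot all_order all_algebra.
From mathcomp Require Import boolp classical_sets fsbigop reals sequences exp.
From mathcomp Require Import complex zify ring lra.
Import Order.TTheory GRing.Theory Num.Theory.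
Local Open Scope ring_scope.
Local Open Scope complex_scope.
Local Open Scope classical_set_scope.

Set Implicit Arguments.
Unset Strict Implicit.
Unset Printing Implicit Defensive.

(** * The field of Puiseux series *)

Section KMul.
Variable R : realType.
Local Notation C := (R[i]).
Implicit Types a b c : rat -> C.

(** The sum defining [kmul] takes the value 0 by convention when its support is infinite. Every
    computation therefore goes through a duplicate-free list containing the support. *)
Lemma kmul_seq a b (S : seq rat) q : uniq S ->
  (forall p, a p != 0 -> b (q - p) != 0 -> p \in S) ->
  kmul a b q = \sum_(p <- S) a p * b (q - p).
Proof.
move=> uS hS; rewrite /kmul (fsbigE S) //; first by apply: eq_bigl => p; rewrite in_setT.
move=> p _; apply: contraNeq; rewrite mulf_eq0 negb_or => /andP[]; exact: hS.
Qed.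

Lemma kmul_supp a b q : kmul a b q != 0 ->
  exists p, a p != 0 /\ b (q - p) != 0.
Proof.
move=> h; apply: contrapT => nh; move/eqP: h; apply.
rewrite /kmul fsbig1 // => p _; apply/eqP; rewrite mulf_eq0.
case: eqVneq => //= a0; case: eqVneq => //= b0.
by case: nh; exists p.
Qed.

(** Phrased with [Num.int], the lattice condition is preserved by sums and products because the
    integers form a subring. *)
Lemma puiseuxP a : puiseux a <-> exists (N : nat) (M : rat), (0 < N)%N /\
  forall q, a q != 0 -> q * N%:R \is a Num.int /\ q <= M.
Proof.
split=> -[N [M [N0 h]]]; exists N, M; split=> // q /h[].
  move=> [z ->] ?; split=> //; rewrite divfK ?pnatr_eq0 -?lt0n //.
move=> /intrP[z hz] ?; split=> //; exists z.
by rewrite -hz mulfK // pnatr_eq0 -lt0n.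
Qed.

(** A lattice has finitely many points between [m] and the upper bound of the exponents; this is
    what makes products finite sums. *)
Lemma puiseux_finite a (m : rat) : puiseux a ->
  exists S, uniq S /\ forall p, a p != 0 -> m <= p -> p \in S.
Proof.
move=> /puiseuxP[N [M [N0 h]]].
(* An exponent z/N between m and M has |z| <= (|m| + |M|) N < n. *)
pose n := Num.bound ((`|m| + `|M|) * N%:R).
pose S := [seq i%:R / N%:R | i <- iota 0 n] : seq rat.
exists (undup (S ++ [seq - x | x <- S])); split; first exact: undup_uniq.
move=> p /h[/intrP[z hz] pM] mp; rewrite mem_undup mem_cat.
have N0' : (0 : rat) < N%:R by rewrite ltr0n.
have zn : (`|z| < n)%N.
  rewrite -(ltr_nat rat); apply: le_lt_trans (archi_boundP _); last first.
    by rewrite mulr_ge0 ?addr_ge0.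
  rewrite natr_absz intr_norm -hz normrM.
  rewrite (ger0_norm (ltW N0')) ler_wpM2r //.
  have m1 : - `|m| <= m by rewrite lerNl -normrN ler_norm.
  have M1 : M <= `|M| by rewrite ler_norm.
  have [m2 M2] : 0 <= `|m| /\ 0 <= `|M| by [].
  by rewrite ler_norml; apply/andP; split; lra.
have pz : p = z%:~R / N%:R by rewrite -hz mulfK // gt_eqF.
have inS k : (k < n)%N -> (k%:R / N%:R : rat) \in S.
  by move=> kn; apply/mapP; exists k; rewrite // mem_iota.
case: (intP z) pz zn => [|k|k] -> zn; apply/orP.
- by left; apply: (inS 0%N).
- by left; apply: (inS k.+1).
- right; apply/mapP; exists (k.+1%:R / N%:R); first exact: inS.
  by rewrite mulrNz mulNr.
Qed.

Lemma kmulC a b : kmul a b = kmul b a.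
Proof.
apply/funext=> q; rewrite /kmul.
rewrite (reindex_fsbig (fun p => q - p) setT setT) /=; last first.
  split=> //; first by move=> x y _ _ /=; lra.
  by move=> y _; exists (q - y) => //=; lra.
by apply: eq_fsbigr => p _; rewrite mulrC; congr (b _ * a _); lra.
Qed.

Lemma puiseux_mul a b : puiseux a -> puiseux b -> puiseux (kmul a b).
Proof.
move=> /puiseuxP[N [M [N0 h]]] /puiseuxP[N' [M' [N0' h']]].
apply/puiseuxP; exists (N * N')%N, (M + M'); split; first by rewrite muln_gt0 N0.
move=> q /kmul_supp[p [/h[p1 p2] /h'[q1 q2]]]; split; last by lra.
have -> : q * (N * N')%:R = p * N%:R * N'%:R + (q - p) * N'%:R * N%:R :> rat.
  by rewrite natrM; ring.
by rewrite rpredD // rpredM // ?natr_int.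
Qed.

Lemma puiseux_add a b : puiseux a -> puiseux b -> puiseux (kadd a b).
Proof.
move=> /puiseuxP[N [M [N0 h]]] /puiseuxP[N' [M' [N0' h']]].
apply/puiseuxP; exists (N * N')%N, (Num.max M M'); split; first by rewrite muln_gt0 N0.
move=> q; rewrite /kadd natrM le_max; have [a0|/h[h1 ->] _] := eqVneq (a q) 0.
  by rewrite a0 add0r => /h'[h1 ->]; rewrite orbT mulrCA rpredM ?natr_int.
by rewrite mulrA rpredM ?natr_int.
Qed.

Lemma puiseux_opp a : puiseux a -> puiseux (kopp a).
Proof.
by move=> [N [M [N0 h]]]; exists N, M; split=> // q; rewrite /kopp oppr_eq0 => /h.
Qed.

Definition kmono (c : C) (v : rat) : rat -> C := fun q => if q == v then c else 0.

Lemma puiseux_mono (c : C) v : puiseux (kmono c v).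
Proof.
apply/puiseuxP; exists `|denq v|%N, v; rewrite absz_gt0 denq_neq0; split=> // q.
rewrite /kmono; have [->|_] := eqVneq q v; last by rewrite eqxx.
move=> _; split=> //; rewrite natr_absz ger0_norm ?denq_ge0 //.
by rewrite -numqE intr_int.
Qed.

Lemma puiseux0 : puiseux (@kzero R).
Proof. by exists 1%N, 0; split=> // q; rewrite eqxx. Qed.

Lemma kmono_mul (c : C) v a q : kmul (kmono c v) a q = c * a (q - v).
Proof.
rewrite (@kmul_seq _ _ [:: v]) //; first by rewrite big_seq1 /kmono eqxx.
by move=> p; rewrite /kmono inE; case: (eqVneq p v) => // _; rewrite eqxx.
Qed.

Lemma puiseux_common a b q : puiseux a -> puiseux b ->
  exists S, uniq S /\ forall p, a p != 0 -> b (q - p) != 0 -> p \in S.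
Proof.
move=> pa [N [M [_ h]]]; have [S [uS hS]] := puiseux_finite (q - M) pa.
by exists S; split=> // p /hS ap /h[_ bp]; apply: ap; lra.
Qed.

Lemma kmulA a b c : puiseux a -> puiseux b -> puiseux c ->
  kmul a (kmul b c) = kmul (kmul a b) c.
Proof.
move=> pa pb pc; apply/funext => q.
have [Na [Ma [_ ha]]] := pa; have [Nb [Mb [_ hb]]] := pb.
have [Nc [Mc [_ hc]]] := pc.
(* When three exponents with nonzero coefficients in [a], [b], [c] add up to [q], upper bounds on
   two of them bound the third from below. The lists [S] and [T] thus depend on [q] alone, and the
   two summations can be exchanged. *)
have [S [uS hS]] := puiseux_finite (q - Mb - Mc) pa.
have [T [uT hT]] := puiseux_finite (q - Ma - Mb) pc.
rewrite [RHS](congr1 (@^~ q) (kmulC _ _)).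
rewrite (@kmul_seq _ _ S) //; last first.
  move=> p ap /kmul_supp[r [/hb[_ br] /hc[_ cr]]]; apply: hS => //; lra.
rewrite (@kmul_seq _ _ T) //; last first.
  move=> p cp /kmul_supp[r [/ha[_ ar] /hb[_ br]]]; apply: hT => //; lra.
transitivity (\sum_(r <- S) \sum_(p <- T) a r * (c p * b (q - r - p))).
  apply: eq_bigr => r _; have [->|ar] := eqVneq (a r) 0.
    by rewrite mul0r big1 // => p _; rewrite mul0r.
  rewrite kmulC (@kmul_seq _ _ T) // ?mulr_sumr // => p cp /hb[_ bp].
  by apply: hT => //; have [_] := ha _ ar; lra.
rewrite exchange_big; apply: eq_bigr => p _; have [->|cp] := eqVneq (c p) 0.
  by rewrite mul0r big1 // => r _; rewrite mul0r mulr0.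
rewrite (@kmul_seq a b S) // ?mulr_sumr.
  by apply: eq_bigr => r _; rewrite mulrCA; congr (_ * (_ * b _)); lra.
move=> r ar /hb[_ br]; apply: hS => //; have [_] := hc _ cp; lra.
Qed.

Lemma kmulDl a b c : puiseux a -> puiseux b -> puiseux c ->
  kmul (kadd a b) c = kadd (kmul a c) (kmul b c).
Proof.
move=> pa pb pc; apply/funext => q; rewrite /kadd.
have [S [uS hS]] := puiseux_common q pc pa.
have [T [uT hT]] := puiseux_common q pc pb.
rewrite !(congr1 (@^~ q) (kmulC _ c)).
have sum_undup d : (forall p, c p != 0 -> d (q - p) != 0 -> p \in undup (S ++ T)) ->
    kmul c d q = \sum_(p <- undup (S ++ T)) c p * d (q - p).
  by apply: kmul_seq; exact: undup_uniq.
have inS p : c p != 0 -> a (q - p) != 0 -> p \in undup (S ++ T).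
  by move=> cp ap; rewrite mem_undup mem_cat (hS p).
have inT p : c p != 0 -> b (q - p) != 0 -> p \in undup (S ++ T).
  by move=> cp bp; rewrite mem_undup mem_cat (hT p) ?orbT.
rewrite (sum_undup a inS) (sum_undup b inT) sum_undup; last first.
  move=> p cp; have [a0|ap _] := eqVneq (a (q - p)) 0; last exact: inS.
  by rewrite a0 add0r; apply: inT.
by rewrite -big_split; apply: eq_bigr => p _; rewrite mulrDr.
Qed.
End KMul.

(** * Puiseux series as a type with field structure, and their valuations *)

Record puiseuxSeries (R : realType) := PuiseuxSeries {
  pcoef :> rat -> R[i];
  pcoefP : puiseux pcoef }.

Section PseriesField.
Variable R : realType.
Local Notation K := (puiseuxSeries R).
Implicit Types a b c : K.

Lemma puiseuxSeriesP a b : a =1 b -> a = b.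
Proof.
case: a b => [a pa] [b pb] /= /funext eqab; rewrite eqab in pa *.
by congr PuiseuxSeries; exact: Prop_irrelevance.
Qed.

HB.instance Definition _ := gen_eqMixin K.
HB.instance Definition _ := gen_choiceMixin K.

Definition padd a b : K := PuiseuxSeries (puiseux_add (pcoefP a) (pcoefP b)).
Definition popp a : K := PuiseuxSeries (puiseux_opp (pcoefP a)).
Definition pzero : K := PuiseuxSeries (puiseux0 R).
Definition pmul a b : K := PuiseuxSeries (puiseux_mul (pcoefP a) (pcoefP b)).
Definition pmono (c : R[i]) v : K := PuiseuxSeries (puiseux_mono c v).

Fact paddA : associative padd.
Proof. by move=> a b c; apply: puiseuxSeriesP => q /=; rewrite /kadd /= addrA. Qed.
Fact paddC : commutative padd.
Proof. by move=> a b; apply: puiseuxSeriesP => q /=; rewrite /kadd addrC. Qed.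
Fact padd0 : left_id pzero padd.
Proof. by move=> a; apply: puiseuxSeriesP => q /=; rewrite /kadd add0r. Qed.
Fact paddN : left_inverse pzero popp padd.
Proof. by move=> a; apply: puiseuxSeriesP => q /=; rewrite /kadd addNr. Qed.
HB.instance Definition _ := GRing.isZmodule.Build K paddA paddC padd0 paddN.

Fact pmulA : associative pmul.
Proof.
by move=> a b c; apply: puiseuxSeriesP => q /=; rewrite kmulA //; exact: pcoefP.
Qed.
Fact pmulC : commutative pmul.
Proof. by move=> a b; apply: puiseuxSeriesP => q /=; rewrite kmulC. Qed.
Fact pmul1 : left_id (pmono 1 0) pmul.
Proof.
by move=> a; apply: puiseuxSeriesP => q /=; rewrite kmono_mul mul1r subr0.
Qed.
Fact pmulDl : left_distributive pmul padd.
Proof.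
by move=> a b c; apply: puiseuxSeriesP => q /=; rewrite kmulDl //; exact: pcoefP.
Qed.
Fact pone_neq0 : pmono 1 0 != 0.
Proof.
apply/eqP => /(congr1 (fun a : K => a 0)) /=; rewrite /kmono eqxx.
by move/eqP; rewrite oner_eq0.
Qed.
HB.instance Definition _ := GRing.Zmodule_isComNzRing.Build K
  pmulA pmulC pmul1 pmulDl pone_neq0.

Lemma pcoefD a b q : (a + b) q = a q + b q. Proof. by []. Qed.
Lemma pcoefN a q : (- a) q = - a q. Proof. by []. Qed.
Lemma pcoefB a b q : (a - b) q = a q - b q. Proof. by []. Qed.
Lemma pcoef_sum (I : Type) (s : seq I) (F : I -> K) q :
  (\sum_(i <- s) F i) q = \sum_(i <- s) F i q.
Proof. by apply: (big_morph (fun a : K => a q)). Qed.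
Lemma pcoef_monoM (c : R[i]) v a q : (pmono c v * a) q = c * a (q - v).
Proof. exact: kmono_mul. Qed.
Lemma pcoef_mulP a b q : (a * b) q != 0 -> exists p, a p != 0 /\ b (q - p) != 0.
Proof. exact: kmul_supp. Qed.

(* Valuation at most v: a = a(v) t^v + lower terms, where a(v) may be 0. *)
Definition vle (v : rat) a := forall q, v < q -> a q = 0.

Lemma vleW v w a : v <= w -> vle v a -> vle w a.
Proof. by move=> vw va q wq; apply: va; apply: le_lt_trans wq. Qed.

Lemma vle0 v : vle v 0. Proof. by []. Qed.

Lemma vleD v a b : vle v a -> vle v b -> vle v (a + b).
Proof. by move=> va vb q vq; rewrite pcoefD va // vb // addr0. Qed.

Lemma vleN v a : vle v a -> vle v (- a).
Proof. by move=> va q vq; rewrite pcoefN va // oppr0. Qed.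

Lemma vleB v a b : vle v a -> vle v b -> vle v (a - b).
Proof. by move=> va vb; apply: vleD => //; apply: vleN. Qed.

Lemma vleM v w a b : vle v a -> vle w b -> vle (v + w) (a * b).
Proof.
move=> va wb q vwq; apply/eqP/contraT => /pcoef_mulP[p [ap bp]].
have pv : p <= v by rewrite leNgt; apply: contraNN ap => /va ->.
have : q - p <= w by rewrite leNgt; apply: contraNN bp => /wb ->.
by move=> ?; suff : false by []; lra.
Qed.

Lemma pcoefM v w a b : vle v a -> vle w b -> (a * b) (v + w) = a v * b w.
Proof.
move=> va wb; rewrite [LHS](@kmul_seq _ _ _ [:: v]) //.
  by rewrite big_seq1; congr (_ * b _); lra.
move=> p ap bp; have pv : p <= v by rewrite leNgt; apply: contraNN ap => /va ->.
have bw : v + w - p <= w by rewrite leNgt; apply: contraNN bp => /wb ->.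
by rewrite inE; apply/eqP; lra.
Qed.

Lemma vle_mono (c : R[i]) v : vle v (pmono c v).
Proof. by move=> q vq; rewrite /= /kmono gt_eqF. Qed.

Lemma mono_coef (c : R[i]) v : pmono c v v = c. Proof. by rewrite /= /kmono eqxx. Qed.

Lemma pmonoM (c d : R[i]) v w : pmono c v * pmono d w = pmono (c * d) (v + w).
Proof.
apply: puiseuxSeriesP => q; rewrite pcoef_monoM /= /kmono subr_eq [w + v]addrC.
by case: ifP; rewrite // mulr0.
Qed.

Lemma pmono1 : pmono 1 0 = 1. Proof. by []. Qed.

(** Above the exponent of any nonzero coefficient there are only finitely many others, so a largest
    one exists. *)
Lemma series_lead a : a != 0 -> exists v, vle v a /\ a v != 0.
Proof.
move=> a0; have [p ap] : exists p, a p != 0.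
  apply: contrapT => h; move/eqP: a0; apply; apply: puiseuxSeriesP => q.
  by apply/eqP; apply: contrapT => /negP aq; apply: h; exists q.
have [S [uS hS]] := puiseux_finite p (pcoefP a).
have pS : p \in [seq q <- S | a q != 0] by rewrite mem_filter ap hS.
have [v vS vmax] : exists2 v, v \in [seq q <- S | a q != 0] &
    forall q, q \in [seq q <- S | a q != 0] -> q <= v.
  move: pS; set s := filter _ _; elim: s (p) => // x s IH y _.
  case: s IH => [|z s] IH.
    by exists x; rewrite ?mem_head // => q; rewrite inE => /eqP ->.
  have [v vs hv] := IH z (mem_head _ _); exists (Num.max x v).
    by rewrite inE /Num.max; case: ifP; rewrite ?eqxx ?vs ?orbT.
  by move=> q; rewrite inE le_max => /orP[/eqP -> | /hv ->]; rewrite ?lexx ?orbT.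
move: vS; rewrite mem_filter => /andP[av _]; exists v; split=> // q vq.
apply/eqP/contraT => aq; have := vmax q; rewrite mem_filter aq hS //.
  by move/(_ isT); rewrite leNgt vq.
by rewrite (le_trans _ (ltW vq)) // vmax.
Qed.

(** Powers of a series keep its common denominator [N]; hence the infinite sum of these powers is
    again a Puiseux series. *)
Definition plattice (N : nat) a := forall q, a q != 0 -> q * N%:R \is a Num.int.

Lemma plattice_exp N a k : plattice N a -> plattice N (a ^+ k).
Proof.
move=> ha; elim: k => [|k IH] q.
  rewrite expr0 -pmono1 /= /kmono; have [->|_] := eqVneq q 0.
    by rewrite mul0r.
  by rewrite eqxx.
rewrite exprS => /pcoef_mulP[p [/ha p1 /IH p2]].
by rewrite -(subrK p q) mulrDl rpredD.
Qed.

Lemma vle_exp v a k : vle v a -> vle (v *+ k) (a ^+ k).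
Proof.
move=> va; elim: k => [|k IH]; first exact: vle_mono.
by rewrite exprS mulrS; apply: vleM.
Qed.

(* Geometric series: each coefficient of sum_k x^k is a finite sum. *)
Lemma geometric_inverse (x : K) : (forall q : rat, 0 <= q -> x q = 0) ->
  exists y : K, (1 - x) * y = 1.
Proof.
move=> x0; have /puiseuxP[N [M [N0 hN]]] := pcoefP x.
have N0' : (0 : rat) < N%:R by rewrite ltr0n.
have lx : plattice N x by move=> q /hN[].
(* A negative exponent in (1/N)Z is at most -1/N, so each further power of [x] descends by at least
   1/N. *)
have vx : vle (- N%:R^-1) x.
  move=> q Nq; apply/eqP/contraT => xq.
  have : q < 0 by rewrite ltNge; apply: contraNN xq => /x0 ->.
  rewrite -(pmulr_llt0 _ N0'); have /intrP[z hz] := lx _ xq.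
  rewrite hz ltrz0 => z0; have : q * N%:R <= -1.
    by rewrite hz -[-1]/((-1)%:~R) ler_int; case: (z) z0 => // n _; lia.
  by rewrite -ler_pdivlMr // mulN1r leNgt Nq.
have xexp0 k (q : rat) : - q * N%:R < k%:R -> (x ^+ k) q = 0.
  move=> qk; have vk := vle_exp (k := k) vx; apply: vk; rewrite mulNrn -[_^-1 *+ _]mulr_natl.
  by rewrite ltrNl ltr_pdivlMr.
(* Powers of [x] from the [bd q]-th on have no term of exponent [q], so cutting the sum there gives
   its exact coefficient. *)
pose bd (q : rat) := Num.bound (`|q| * N%:R).
have bdP q k : (bd q <= k)%N -> - q * N%:R < k%:R.
  move=> qk; apply: (@lt_le_trans _ _ (bd q)%:R); last by rewrite ler_nat.
  apply: le_lt_trans (archi_boundP _); last by rewrite mulr_ge0.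
  by rewrite ler_pM2r // -normrN ler_norm.
pose s n : K := \sum_(0 <= k < n) x ^+ k.
pose y q := s (bd q) q.
have yE (q : rat) n : - q * N%:R < n%:R -> y q = s n q.
  have aux m l : - q * N%:R < m%:R -> (m <= l)%N -> s m q = s l q.
    move=> qm ml; rewrite /s [X in _ = pcoef X _](big_cat_nat (leq0n m) ml) // pcoefD.
    rewrite [X in _ + X]pcoef_sum [X in _ + X]big_nat_cond [X in _ + X]big1 ?addr0 //.
    move=> k /andP[/andP[mk _] _]; apply: xexp0; apply: lt_le_trans qm _.
    by rewrite ler_nat.
  move=> qn; have [nb|/ltnW bn] := leqP n (bd q); first by rewrite (aux n (bd q)).
  by rewrite /y (aux _ n) // bdP.
have py : puiseux y.
  apply/puiseuxP; exists N, 0; split=> // q; rewrite /y /s pcoef_sum => yq.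
  have [k xk] : exists k, (x ^+ k) q != 0.
    apply: contrapT => h; move/eqP: yq; apply; apply: big1 => k _.
    by apply/eqP; apply: contrapT => /negP ?; apply: h; exists k.
  split; first exact: plattice_exp xk.
  rewrite leNgt; apply: contraNN xk => q0; apply/eqP; apply: (vle_exp vx).
  by apply: le_lt_trans q0; rewrite mulrn_wle0 // oppr_le0 invr_ge0 ltW.
exists (PuiseuxSeries py); apply: puiseuxSeriesP => q; set n := bd q.
have qn : - q * N%:R < n%:R by apply: bdP.
(* Since [x] has only negative exponents, the coefficient of the product at [q] involves [y] only at
   exponents at least [q], where it agrees with the partial sum [s n]. *)
have -> : ((1 - x) * PuiseuxSeries py) q = ((1 - x) * s n) q.
  rewrite !mulrBl !mul1r !pcoefB /= (yE _ n) //; congr (_ - _).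
  have [S [uS hS]] := puiseux_finite (q - 0) (pcoefP x).
  have e (z : K) : (forall p, q <= p -> z p = y p) -> (x * z) q = kmul x y q.
    move=> zy; apply: eq_fsbigr => p _; have [->|xp] := eqVneq (x p) 0.
      by rewrite !mul0r.
    rewrite zy //; have : p < 0 by rewrite ltNge; apply: contraNN xp => /x0 ->.
    lra.
  rewrite [RHS]e // => p qp; rewrite (yE _ n) //.
  by apply: le_lt_trans qn; rewrite ler_pM2r // lerN2.
rewrite /s big_mkord -opprB mulNr -subrX1 opprB pcoefB (xexp0 n) // subr0 //.
Qed.

(** Multiplication by the inverse [m] of the leading monomial turns [a] into 1 minus a series with
    negative exponents only. *)
Lemma series_inverse a : a != 0 -> exists b, b * a = 1.
Proof.
move=> /series_lead[v [va av0]].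
pose m := pmono (a v)^-1 (- v).
have [|y hy] := @geometric_inverse (1 - m * a).
  move=> q; rewrite pcoefB pcoef_monoM opprK le_eqVlt => /predU1P[<-|q0].
    by rewrite add0r mulVf // -pmono1 mono_coef subrr.
  by rewrite (va (q + v)) ?ltrDr // mulr0 subr0; apply: (@vle_mono 1 0).
by exists (y * m); rewrite -hy; ring.
Qed.

(** An inverse is picked by choice; the default 0 gives the convention that the inverse of 0 is
    0. *)
Definition pinv a : K :=
  if pselect (exists b, b * a = 1) is left e then projT1 (cid e) else 0.

Fact pmulV a : a != 0 -> pinv a * a = 1.
Proof.
move=> /series_inverse h; rewrite /pinv; case: pselect => // e.
by case: cid.
Qed.

Fact pinv0 : pinv 0 = 0.
Proof.
rewrite /pinv; case: pselect => // e; suff : False by []; case: e => b.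
by rewrite mulr0 => /esym/eqP; rewrite oner_eq0.
Qed.

HB.instance Definition _ := GRing.ComNzRing_isField.Build K pmulV pinv0.

End PseriesField.

(** * Leading terms of matrices on the line *)

Section Det2.
Variable F : comNzRingType.
Implicit Types A B : 'M[F]_2.

Lemma det_mx22 A :
  \det A = A ord0 ord0 * A ord_max ord_max - A ord0 ord_max * A ord_max ord0.
Proof.
rewrite (expand_det_row _ ord0) !big_ord_recl big_ord0 addr0 /cofactor !det_mx11 !mxE /=.
rewrite !expr0 !expr1.
have e1 : lift ord0 ord0 = ord_max :> 'I_2 by apply: val_inj.
have e2 : lift (lift ord0 ord0) ord0 = ord0 :> 'I_2 by apply: val_inj.
by rewrite /= !e2 !e1; ring.
Qed.

(** The polarization of the determinant, written out over any commutative ring. For singular [A] and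
    [B] it vanishes exactly when all their combinations are singular. *)
Definition mpolar A B : F :=
  A ord0 ord0 * B ord_max ord_max + B ord0 ord0 * A ord_max ord_max
  - A ord0 ord_max * B ord_max ord0 - B ord0 ord_max * A ord_max ord0.

Lemma det_lin l m A B :
  \det (l *: A + m *: B) = l ^+ 2 * \det A + m ^+ 2 * \det B + l * m * mpolar A B.
Proof. by rewrite !det_mx22 /mpolar !mxE; ring. Qed.

Lemma mpolarE A B : mpolar A B = \det (A + B) - \det A - \det B.
Proof. by rewrite !det_mx22 /mpolar !mxE; ring. Qed.

Lemma mpolar_linr A l B m D :
  mpolar A (l *: B + m *: D) = l * mpolar A B + m * mpolar A D.
Proof. by rewrite /mpolar !mxE; ring. Qed.

Lemma mpolarZr A l B : mpolar A (l *: B) = l * mpolar A B.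
Proof. by rewrite /mpolar !mxE; ring. Qed.

Lemma mpolarZl A l B : mpolar (l *: A) B = l * mpolar A B.
Proof. by rewrite /mpolar !mxE; ring. Qed.

Lemma mpolarxx A : mpolar A A = 2 * \det A.
Proof. by rewrite det_mx22 /mpolar; ring. Qed.

Lemma det_scale2 l A : \det (l *: A) = l ^+ 2 * \det A.
Proof. by rewrite !det_mx22 !mxE; ring. Qed.
End Det2.

(** * Valuations of inverses and matrices; independent leading matrices *)

Section Valuation.
Variable R : realType.
Local Notation C := (R[i]).
Local Notation K := (puiseuxSeries R).
Implicit Types (a b l : K) (M N P E : 'M[K]_2).

Lemma pcoef1 (q : rat) : q != 0 -> (1 : K) q = 0.
Proof. by rewrite -pmono1 /= /kmono => /negPf ->. Qed.

Lemma pcoef10 : (1 : K) 0 = 1.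
Proof. by rewrite -pmono1 mono_coef. Qed.

Lemma vle_neq0 v a : a v != 0 -> a != 0.
Proof. by apply: contraNneq => ->. Qed.

(** The product of the leading coefficients of [a] and [a^-1] is nonzero, so it is the constant term
    of 1. *)
Lemma vle_inv v a : vle v a -> a v != 0 ->
  vle (- v) a^-1 /\ a^-1 (- v) = (a v)^-1.
Proof.
move=> va av; have a0 : a != 0 by apply: vle_neq0 av.
have /series_lead[w [wa aw]] : a^-1 != 0 by rewrite invr_eq0.
have := pcoefM va wa; rewrite mulfV // => e.
have vw : v + w = 0.
  apply/eqP; apply: contraT => /pcoef1 h; move: e; rewrite h => /esym/eqP.
  by rewrite mulf_eq0 (negPf av) (negPf aw).
have -> : - v = w by lra.
split=> //; apply: (mulfI av); rewrite -e vw pcoef10 mulfV //.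
Qed.

(** The coefficient of t^v; it is the leading matrix of [M] when it is nonzero and [mvle v M]
    holds. *)
Definition cf v M : 'M[C]_2 := \matrix_(i, j) M i j v.
Definition mvle v M := forall i j, vle v (M i j).

Lemma cfD v M N : cf v (M + N) = cf v M + cf v N.
Proof. by apply/matrixP => i j; rewrite !mxE. Qed.

Lemma cfZ v w a M : vle v a -> mvle w M -> cf (v + w) (a *: M) = a v *: cf w M.
Proof. by move=> va wM; apply/matrixP => i j; rewrite !mxE pcoefM. Qed.

Lemma cf_lt v w M : mvle v M -> v < w -> cf w M = 0.
Proof. by move=> vM vw; apply/matrixP => i j; rewrite !mxE vM. Qed.

Lemma mvleW v w M : v <= w -> mvle v M -> mvle w M.
Proof. by move=> vw vM i j; apply: vleW vw _. Qed.

Lemma mvleD v M N : mvle v M -> mvle v N -> mvle v (M + N).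
Proof. by move=> vM vN i j; rewrite mxE; apply: vleD. Qed.

Lemma mvleZ v w a M : vle v a -> mvle w M -> mvle (v + w) (a *: M).
Proof. by move=> va wM i j; rewrite mxE; apply: vleM. Qed.

Lemma mvle_unique v w M : mvle v M -> cf v M != 0 -> mvle w M -> cf w M != 0 -> v = w.
Proof.
move=> vM Mv wM Mw; apply/eqP; rewrite eq_le; apply/andP; split.
  by rewrite leNgt; apply: contraNN Mv => /(cf_lt wM) ->.
by rewrite leNgt; apply: contraNN Mw => /(cf_lt vM) ->.
Qed.

Lemma matrix_lead M : M != 0 -> exists v, mvle v M /\ cf v M != 0.
Proof.
move=> M0; have [p0 hp0] : exists p : 'I_2 * 'I_2, M p.1 p.2 != 0.
  apply: contrapT => h; move/eqP: M0; apply; apply/matrixP => i j; rewrite mxE.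
  by apply/eqP; apply: contrapT => /negP ?; apply: h; exists (i, j).
have /choice[lead leadP] : forall p : 'I_2 * 'I_2, exists v : rat,
    M p.1 p.2 != 0 -> vle v (M p.1 p.2) /\ M p.1 p.2 v != 0.
  (* The default 0 for zero entries has no influence, as the maximum runs over the nonzero
     entries. *)
  move=> p; have [->|/series_lead[v hv]] := eqVneq (M p.1 p.2) 0; first by exists 0.
  by exists v.
have [p /= hp pmax] := @arg_maxP _ _ _ p0 (fun p => M p.1 p.2 != 0) lead hp0.
have [vp Mp] := leadP p hp; exists (lead p); split.
  move=> i j; have [->|Mij] := eqVneq (M i j) 0; first exact: vle0.
  by have [+ _] := leadP (i, j) Mij; apply: vleW; apply: pmax.
by apply: contraNneq Mp => /matrixP/(_ p.1 p.2); rewrite !mxE => ->.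
Qed.

Lemma cf_polar v w M N : mvle v M -> mvle w N ->
  vle (v + w) (mpolar M N) /\ mpolar M N (v + w) = mpolar (cf v M) (cf w N).
Proof.
move=> vM wN; have wv i j k m : vle (v + w) (N i j * M k m).
  by rewrite addrC; apply: vleM.
have vw i j k m : vle (v + w) (M i j * N k m) by apply: vleM.
split; first by rewrite /mpolar; do ?[apply: vleB | apply: vleD].
have e i j k m : (M i j * N k m) (v + w) = cf v M i j * cf w N k m.
  by rewrite (pcoefM (vM _ _) (wN _ _)) !mxE.
have e' i j k m : (N i j * M k m) (v + w) = cf w N i j * cf v M k m.
  by rewrite mulrC e mulrC.
by rewrite /mpolar !pcoefB pcoefD !e !e'.
Qed.

Lemma cf_det v M : mvle v M ->
  vle (v + v) (\det M) /\ \det M (v + v) = \det (cf v M).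
Proof.
move=> vM; have vv i j k m : vle (v + v) (M i j * M k m) by apply: vleM.
split; first by rewrite det_mx22; apply: vleB.
by rewrite !det_mx22 !mxE pcoefB !(pcoefM (vM _ _) (vM _ _)).
Qed.

(* (alpha, Y) is the leading datum of a matrix of determinant one on the line
   spanned by P and P', when det P = det P' = 0 and mpolar P P' = 1. *)
Definition unit_lead P P' alpha (Y : 'M[C]_2) :=
  exists l, l != 0 /\ mvle alpha (l *: P + l^-1 *: P') /\
    Y = cf alpha (l *: P + l^-1 *: P') /\ Y != 0.

Lemma cindep_neq0 (B B' : 'M[C]_2) x y :
  cindep B B' -> (x != 0) || (y != 0) -> x *: B + y *: B' != 0.
Proof. by move=> ind; apply: contraTneq => /ind[-> ->]; rewrite eqxx. Qed.

Lemma cindep_neq0l (B B' : 'M[C]_2) : cindep B B' -> B != 0.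
Proof.
by move=> /(@cindep_neq0 _ _ 1 0); rewrite oner_neq0 scale1r scale0r addr0; apply.
Qed.

Lemma cindep_neq0r (B B' : 'M[C]_2) : cindep B B' -> B' != 0.
Proof.
by move=> /(@cindep_neq0 _ _ 0 1); rewrite oner_neq0 orbT scale1r scale0r add0r; apply.
Qed.

(** If [l] has valuation v, the two summands have valuations r + v and r - v. For v != 0 the larger
    one dominates; for v = 0 both contribute, and independence excludes cancellation. *)
Lemma unit_lead_indep P P' r B B' alpha Y :
  mvle r P -> mvle r P' -> B = cf r P -> B' = cf r P' -> cindep B B' ->
  unit_lead P P' alpha Y <->
    (r < alpha /\ exists c, c != 0 /\ (Y = c *: B \/ Y = c *: B')) \/
    (alpha = r /\ exists c, c != 0 /\ Y = c *: B + c^-1 *: B').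
Proof.
move=> rP rP' eB eB' ind.
have B0 := cindep_neq0l ind; have B'0 := cindep_neq0r ind.
have key l v : vle v l -> l v != 0 -> let M := l *: P + l^-1 *: P' in
    [\/ [/\ 0 < v, mvle (r + v) M & cf (r + v) M = l v *: B],
        [/\ v < 0, mvle (r - v) M & cf (r - v) M = (l v)^-1 *: B'] |
        [/\ v = 0, mvle r M & cf r M = l v *: B + (l v)^-1 *: B']].
  move=> vl lv M; have [vi li] := vle_inv vl lv.
  have lP := mvleZ vl rP; have lP' := mvleZ vi rP'.
  have cP := cfZ vl rP; have cP' := cfZ vi rP'.
  rewrite -eB in cP; rewrite -eB' li in cP'.
  case: (ltrgtP v 0) => v0.
  - constructor 2; split=> //.
      by apply: mvleD; [apply: mvleW lP | apply: mvleW lP']; lra.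
    rewrite cfD (cf_lt lP) ?add0r; last by lra.
    by rewrite -cP'; congr cf; lra.
  - constructor 1; split=> //.
      by apply: mvleD; [apply: mvleW lP | apply: mvleW lP']; lra.
    rewrite cfD [X in _ + X](cf_lt lP') ?addr0; last by lra.
    by rewrite -cP; congr cf; lra.
  - constructor 3; split=> //.
      by apply: mvleD; [apply: mvleW lP | apply: mvleW lP']; lra.
    by rewrite cfD -cP -cP' v0 oppr0 !add0r.
split.
  move=> [l [l0 [aM [-> Y0]]]]; have [v [vl lv]] := series_lead l0.
  case: (key l v vl lv) => -[v0 hM hc].
  - have -> : alpha = r + v.
      by apply: (mvle_unique aM Y0 hM); rewrite hc scaler_eq0 negb_or lv.
    left; split; first by lra.
    by exists (l v); split=> //; left.
  - have -> : alpha = r - v.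
      by apply: (mvle_unique aM Y0 hM); rewrite hc scaler_eq0 negb_or invr_eq0 lv.
    left; split; first by lra.
    by exists (l v)^-1; rewrite invr_eq0; split=> //; right.
  - have -> : alpha = r.
      by apply: (mvle_unique aM Y0 hM); rewrite hc; apply: cindep_neq0 => //; rewrite lv.
    by right; split=> //; exists (l v).
(* Conversely, every leading datum is realized by a monomial [l]. *)
have mono c v : c != 0 -> pmono c v != 0 :> K.
  by move=> c0; apply: (@vle_neq0 v); rewrite mono_coef.
have lmono c v : c != 0 -> pmono c v v != 0 :> C by rewrite mono_coef.
case=> [[ra [c [c0 hY]]] | [-> [c [c0 ->]]]].
  have Y0 : Y != 0 by case: hY => ->; rewrite scaler_eq0 negb_or c0.
  case: hY => eY.
    exists (pmono c (alpha - r)); split; first exact: mono.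
    case: (key _ _ (@vle_mono R c (alpha - r)) (lmono _ _ c0)) => -[v0 hM hc]; try by exfalso; clear -v0 ra; lra.
    move: hM hc; rewrite subrKC mono_coef => hM hc; split=> //; split=> //.
    by rewrite hc.
  have c0' : c^-1 != 0 by rewrite invr_eq0.
  exists (pmono c^-1 (r - alpha)); split; first exact: mono.
  case: (key _ _ (@vle_mono R c^-1 (r - alpha)) (lmono _ _ c0')) => -[v0 hM hc]; try by exfalso; clear -v0 ra; lra.
  move: hM hc; rewrite subKr mono_coef invrK => hM hc; split=> //; split=> //.
  by rewrite hc.
exists (pmono c 0); split; first exact: mono.
case: (key _ _ (@vle_mono R c 0) (lmono _ _ c0)) => -[v0 hM hc]; try by exfalso; clear -v0; lra.
rewrite mono_coef in hc; split=> //; split=> //.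
by apply: cindep_neq0 => //; rewrite c0.
Qed.

End Valuation.

(** * Approximate square roots and prescribed coefficients *)

Section Lifting.
Variable R : realType.
Local Notation C := (R[i]).
Local Notation K := (puiseuxSeries R).
Implicit Types (a b l : K) (M N P E : 'M[K]_2).

Lemma series2_neq0 : (2 : K) != 0.
Proof.
apply: (@vle_neq0 R 0); rewrite -[2]/(1 + 1 : K) pcoefD pcoef10.
by rewrite -[1 + 1]/(2 : C) pnatr_eq0.
Qed.

(** Provides the strictly negative bound on the initial error with which Newton's iteration
    starts. *)
Lemma vle0_lt0 a : vle 0 a -> a 0 = 0 -> exists2 v : rat, v < 0 & vle v a.
Proof.
move=> a0 az; have [->|/series_lead[v [va av]]] := eqVneq a 0.
  by exists (-1); [rewrite ltrN10 | apply: vle0].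
exists v => //; rewrite lt_neqAle; apply/andP; split.
  by apply: contraNneq av => ->; rewrite az.
by rewrite leNgt; apply: contraNN av => /a0 ->.
Qed.

(* Newton's iteration w - (w^2 + u)/(2 w) squares the error w^2 + u. *)
Lemma sqrt_approx u c (eps : rat) : vle 0 u -> c != 0 -> c ^+ 2 = - u 0 ->
  exists w : K, [/\ vle 0 w, w 0 = c & vle eps (w ^+ 2 + u)].
Proof.
move=> vu c0 cu; pose w0 : K := pmono c 0.
have vw0 : vle 0 w0 by exact: vle_mono.
have w00 : w0 0 = c by rewrite mono_coef.
have [d d0 hd] : exists2 d : rat, d < 0 & vle d (w0 ^+ 2 + u).
  apply: vle0_lt0.
    by rewrite expr2; apply: vleD => //; rewrite -[0](addr0 0); apply: vleM.
  rewrite pcoefD expr2 -{1}[0](addr0 0) pcoefM // w00 -expr2 cu.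
  by rewrite addNr.
(* The induction records only that each step lowers the error bound by at least |d|; [n] steps bring
   it down to [eps]. *)
have [n hn] : exists n : nat, d *+ n.+1 <= eps.
  pose m := Num.bound (`|eps| / - d); exists m.
  have nd : 0 < - d by rewrite oppr_gt0.
  have : `|eps| / - d < m%:R.
    by apply: archi_boundP; rewrite mulr_ge0 ?invr_ge0 // ltW.
  rewrite ltr_pdivrMr // mulrN mulr_natl => h.
  have h2 : - eps <= `|eps| by rewrite -normrN ler_norm.
  by rewrite mulrS; lra.
suff [w [w1 w2 w3]] : exists w : K, [/\ vle 0 w, w 0 = c & vle (d *+ n.+1) (w ^+ 2 + u)].
  by exists w; split=> //; apply: vleW hn _.
elim: n {hn} => [|n [w [vw wc we]]]; first by exists w0; rewrite mulr1n.
have wn0 : w != 0 by apply: (@vle_neq0 R 0); rewrite wc.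
have := series2_neq0; set e := w ^+ 2 + u in we * => two0.
have vw2 : vle 0 (2 * w).
  by rewrite mulrDl mul1r; apply: vleD.
have w2n0 : (2 * w) 0 != 0.
  by rewrite mulrDl mul1r pcoefD wc -mulr2n mulrn_eq0.
have [vi _] := vle_inv vw2 w2n0; rewrite oppr0 in vi.
have ve := vleM we vi; rewrite addr0 in ve.
have dn0 : d *+ n.+1 < 0 by rewrite mulrn_wlt0.
exists (w - e * (2 * w)^-1); split.
- by apply: vleB => //; apply: vleW ve; apply: ltW.
- by rewrite pcoefB wc ve // subr0.
- have -> : (w - e * (2 * w)^-1) ^+ 2 + u = (e * (2 * w)^-1) * (e * (2 * w)^-1).
    by rewrite /e; field; apply/andP.
  apply: vleW (vleM ve ve); rewrite [d *+ n.+2]mulrSr.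
  by rewrite lerD2l mulrS gerDl mulrn_wle0 // ltW.
Qed.

(** Perturb an approximate root w of -u by y = (x/2) t^delta and set l = w + y. Then l + u/l = (w^2
    + u + 2wy + y^2)/l, where w^2 + u and y^2 live at exponents at most 2 delta < delta, while 2wy/l
    has coefficient x at delta because w and l share the constant term c. *)
Lemma prescribed_coef u c x (delta : rat) : vle 0 u -> c != 0 ->
  c ^+ 2 = - u 0 -> delta < 0 ->
  exists l : K, [/\ vle 0 l, l 0 = c, vle delta (l + u / l) & (l + u / l) delta = x].
Proof.
move=> vu c0 cu d0; have [w [vw wc we]] := sqrt_approx (delta + delta) vu c0 cu.
pose y : K := pmono (x / 2) delta; pose l := w + y.
have vy : vle delta y by exact: vle_mono.
have vl : vle 0 l by apply: vleD => //; apply: vleW vy; exact: ltW.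
have lc : l 0 = c by rewrite pcoefD wc vy // addr0.
have ln0 : l 0 != 0 by rewrite lc.
have l0 : l != 0 by apply: vle_neq0 ln0.
have [vi li] := vle_inv vl ln0; rewrite oppr0 in vi li.
have E : l + u / l = l^-1 * ((w ^+ 2 + u) + (w * (y + y) + y * y)).
  by rewrite /l; field.
have vyy : vle delta (y + y) by apply: vleD.
have v1 := vleM vw vyy; rewrite add0r in v1.
have v2 := vleM vy vy.
have dd : delta + delta < delta by lra.
have v3 : vle delta (w ^+ 2 + u) by apply: vleW we; exact: ltW.
have v4 : vle delta (y * y) by apply: vleW v2; exact: ltW.
have v5 : vle delta ((w ^+ 2 + u) + (w * (y + y) + y * y)) by apply: vleD v3 _; apply: vleD.
exists l; split=> //; rewrite E.
  by rewrite -[delta]add0r; apply: vleM.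
rewrite -[delta]add0r pcoefM // li lc pcoefD we // add0r pcoefD v2 // addr0.
rewrite -{1}[delta]add0r pcoefM // wc pcoefD mono_coef.
have -> : x / 2 + x / 2 = x by field.
by rewrite mulrA mulVf // mul1r.
Qed.

End Lifting.

(** * Proportional leading matrices *)

Section Degenerate.
Variable R : realType.
Local Notation C := (R[i]).
Local Notation K := (puiseuxSeries R).
Implicit Types (a b l : K) (M N P E : 'M[K]_2).

(** The coefficient [a v] is allowed to be 0, which covers a cancellation in the factor of [P]. *)
Lemma mvle_comb r s al P E a b v w : mvle r P -> mvle s E -> vle v a -> vle w b ->
  v + r = al -> w + s <= al ->
  mvle al (a *: P + b *: E) /\
  cf al (a *: P + b *: E) =
    a v *: cf r P + (if w + s == al then b w *: cf s E else 0).
Proof.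
move=> rP sE va wb <- ws; have aP := mvleZ va rP; have bE := mvleZ wb sE.
split; first by apply: mvleD => //; apply: mvleW bE.
rewrite cfD cfZ //; congr (_ + _); case: eqVneq => [<-|ne]; first by rewrite cfZ.
by apply: (cf_lt bE); rewrite lt_neqAle ne.
Qed.

(** The matrix is (l + u/l) P + l^-1 E. As long as its first summand has valuation above that of the
    second, only a multiple of [B] is seen; otherwise [l] has valuation 0 and both summands
    contribute at exponent [s]. *)
Lemma unit_lead_dep P P' E u r s B D alpha Y :
  mvle r P -> B = cf r P -> mvle s E -> D = cf s E -> P' = u *: P + E ->
  s < r -> cindep B D -> vle 0 u -> u 0 != 0 ->
  unit_lead P P' alpha Y <->
    (s < alpha /\ exists c, c != 0 /\ Y = c *: B) \/
    (alpha = s /\ exists x c, c ^+ 2 = - u 0 /\ Y = x *: B + c^-1 *: D).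
Proof.
move=> rP eB sE eD -> sr ind vu u0.
have Mform l : l *: P + l^-1 *: (u *: P + E) = (l + u / l) *: P + l^-1 *: E.
  by rewrite scalerDr scalerA addrA -scalerDl [l^-1 * u]mulrC.
have B0 := cindep_neq0l ind.
split.
  move=> [l [l0 []]]; rewrite Mform => aM [-> Y0].
  have [v [vl lv]] := series_lead l0; have [vi li] := vle_inv vl lv.
  have lin : l^-1 (- v) != 0 by rewrite li invr_eq0.
  have uniq al c x : mvle al ((l + u / l) *: P + l^-1 *: E) ->
      cf al ((l + u / l) *: P + l^-1 *: E) = c *: B + x *: D ->
      (c != 0) || (x != 0) -> alpha = al.
    by move=> alM e cx; apply: (mvle_unique aM Y0 alM); rewrite e; apply: cindep_neq0.
  have vul : vle (- v) (u / l) by rewrite -[- v]add0r; apply: vleM.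
  have ul : (u / l) (- v) = u 0 / l v by rewrite -[- v]add0r pcoefM // li.
  case: (ltrgtP v 0) => v0.
  - left; have [||||||M1 M2] := @mvle_comb r s (r - v) P E (l + u / l) l^-1 (- v) (- v) => //.
    + by apply: vleD => //; apply: vleW vl; lra.
    + by rewrite addrC.
    + by lra.
    move: M2; rewrite ifF; last by apply/eqP; lra.
    rewrite addr0 pcoefD vl ?add0r ?ul -?eB; last by lra.
    have c0 : u 0 / l v != 0 by rewrite mulf_neq0 ?invr_eq0.
    move=> M2; have e : alpha = r - v.
      by apply: (@uniq _ (u 0 / l v) 0); rewrite ?c0 ?scale0r ?addr0.
    by rewrite e; split; [lra | exists (u 0 / l v)].
  - left; have [||||||M1 M2] := @mvle_comb r s (r + v) P E (l + u / l) l^-1 v (- v) => //.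
    + by apply: vleD => //; apply: vleW vul; lra.
    + by rewrite addrC.
    + by lra.
    move: M2; rewrite ifF; last by apply/eqP; lra.
    rewrite addr0 pcoefD vul ?addr0 -?eB; last by lra.
    move=> M2; have e : alpha = r + v.
      by apply: (@uniq _ (l v) 0); rewrite ?lv ?scale0r ?addr0.
    by rewrite e; split; [lra | exists (l v)].
  - subst v; rewrite oppr0 in vi li lin vul ul.
    have vf : vle 0 (l + u / l) by apply: vleD.
    (* For [l] of valuation 0 the sum [l + u / l] can cancel; its valuation is compared with s - r,
       the value at which the two summands balance. *)
    have [[phi [sphi vphi fphi]]|low] : (exists phi : rat, [/\ s - r < phi,
        vle phi (l + u / l) & (l + u / l) phi != 0]) \/ vle (s - r) (l + u / l).
      have [->|/series_lead[phi [vphi fphi]]] := eqVneq (l + u / l) 0; first by right.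
      have [le|lt] := leP phi (s - r); first by right; apply: vleW vphi.
      by left; exists phi.
    + left; have phi0 : phi <= 0 by rewrite leNgt; apply: contraNN fphi => /vf ->.
      have [||||||M1 M2] := @mvle_comb r s (r + phi) P E (l + u / l) l^-1 phi 0 => //.
      * by rewrite addrC.
      * by lra.
      move: M2; rewrite ifF; last by apply/eqP; lra.
      rewrite addr0 -eB => M2; have e : alpha = r + phi.
        by apply: (@uniq _ ((l + u / l) phi) 0); rewrite ?fphi ?scale0r ?addr0.
      by rewrite e; split; [lra | exists ((l + u / l) phi)].
    + right; have [||||||M1 M2] := @mvle_comb r s s P E (l + u / l) l^-1 (s - r) 0 => //.
      * by rewrite subrK.
      * by lra.
      move: M2; rewrite add0r eqxx -eB -eD => M2.
      have e : alpha = s by apply: (uniq _ _ _ M1 M2); rewrite lin orbT.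
      split=> //; exists ((l + u / l) (s - r)), (l 0); split; last by rewrite e M2 li.
      (* As s - r < 0, the constant term l(0) + u(0)/l(0) vanishes, which is the equation c^2 =
         -u(0). *)
      have : (l + u / l) 0 = 0 by apply: low; lra.
      rewrite pcoefD ul => /eqP; rewrite addr_eq0 => /eqP h.
      by rewrite expr2 {1}h mulNr mulfVK.
(* Conversely, exponents from s up to but excluding r are reached by an [l] close to a square root
   of -u, exponents above r by a monomial, and r itself by a constant. *)
have [c0 c0u] : exists c0 : C, c0 ^+ 2 = - u 0 by exists (sqrtc (- u 0)); rewrite sqr_sqrtc.
have c0n : c0 != 0 by rewrite -sqrf_eq0 c0u oppr_eq0.
have low c x al : c != 0 -> c ^+ 2 = - u 0 -> s <= al -> al < r ->
    x *: B + (if s == al then c^-1 *: D else 0) != 0 ->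
    unit_lead P (u *: P + E) al (x *: B + (if s == al then c^-1 *: D else 0)).
  move=> cn cu sal alr Y0.
  have [|l [vl lc vf fx]] := @prescribed_coef R u c x (al - r) vu cn cu; first by lra.
  have ln0 : l 0 != 0 by rewrite lc.
  have [vi li] := vle_inv vl ln0; rewrite oppr0 lc in vi li.
  have l0 : l != 0 by apply: vle_neq0 ln0.
  have [||||||M1 M2] := @mvle_comb r s al P E (l + u / l) l^-1 (al - r) 0 => //.
  + by rewrite subrK.
  + by rewrite add0r.
  move: M2; rewrite fx add0r -eB -eD li => M2.
  by exists l; rewrite Mform M2.
case=> [[sa [c [cn ->]]] | [-> [x [c [cu ->]]]]]; last first.
  have cn : c != 0 by rewrite -sqrf_eq0 cu oppr_eq0.
  have := low c x s cn cu (lexx s) sr; rewrite eqxx; apply.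
  by apply: cindep_neq0; rewrite ?invr_eq0 ?cn ?orbT.
have cB0 : c *: B != 0 by rewrite scaler_eq0 negb_or cn.
case: (ltrgtP alpha r) => ar.
- have := low c0 c alpha c0n c0u (ltW sa) ar.
  by rewrite lt_eqF // addr0; apply.
- pose l : K := pmono c (alpha - r).
  have vl : vle (alpha - r) l by exact: vle_mono.
  have lv : l (alpha - r) != 0 by rewrite mono_coef.
  have [vi li] := vle_inv vl lv.
  have vul : vle (- (alpha - r)) (u / l) by rewrite -[- _]add0r; apply: vleM.
  have [||||||M1 M2] := @mvle_comb r s alpha P E (l + u / l) l^-1 (alpha - r) (- (alpha - r)) => //.
  + by apply: vleD => //; apply: vleW vul; lra.
  + by rewrite subrK.
  + by lra.
  move: M2; rewrite ifF; last by apply/eqP; lra.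
  rewrite addr0 pcoefD vul ?addr0 -?eB ?mono_coef; last by lra.
  by move=> M2; exists l; rewrite Mform M2; split=> //; apply: vle_neq0 lv.
(* At exponent r a constant [c1] with c1 + u(0)/c1 = c is wanted, that is, a root of X^2 - c X +
   u(0); it is nonzero because u(0) is. *)
- pose w := sqrtc ((c / 2) ^+ 2 - u 0).
  have ww : w ^+ 2 = (c / 2) ^+ 2 - u 0 by rewrite /w sqr_sqrtc.
  pose c1 := c / 2 + w.
  have c1e : c1 ^+ 2 - c * c1 + u 0 = 0.
    have -> : u 0 = (c / 2) ^+ 2 - w ^+ 2 by rewrite ww; ring.
    by rewrite /c1; field.
  have c1n : c1 != 0.
    apply: contraNneq u0 => c10; move: c1e; rewrite c10 expr0n /= mulr0 subr0 add0r.
    by move->.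
  pose l : K := pmono c1 0.
  have vl : vle 0 l by exact: vle_mono.
  have l0c : l 0 = c1 by rewrite mono_coef.
  have lv : l 0 != 0 by rewrite l0c.
  have [vi li] := vle_inv vl lv; rewrite oppr0 l0c in vi li.
  have vul : vle 0 (u / l) by rewrite -[0]add0r; apply: vleM.
  have ul0 : (u / l) 0 = u 0 / c1 by rewrite -li -(pcoefM vu vi) addr0.
  have [||||||M1 M2] := @mvle_comb r s alpha P E (l + u / l) l^-1 0 0 => //.
  + by apply: vleD.
  + by rewrite add0r.
  + by lra.
  move: M2; rewrite ifF; last by apply/eqP; lra.
  rewrite addr0 pcoefD l0c ul0 -eB.
  have -> : c1 + u 0 / c1 = c.
    move/eqP: c1e; rewrite addrC addr_eq0 opprB => /eqP ->.
    by field.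
  by move=> M2; exists l; rewrite Mform M2; split=> //; apply: vle_neq0 lv.
Qed.
End Degenerate.

(** * Reduction to matrices over the field *)

Section Reduction.
Variable R : realType.
Local Notation C := (R[i]).
Local Notation K := (puiseuxSeries R).
Implicit Types (M N P : 'M[K]_2).

Definition kmat M : Kmat R := fun i j => M i j.

Lemma kmatP (A : Kmat R) : kmat_puiseux A -> exists M, A = kmat M.
Proof.
move=> pA; exists (\matrix_(i, j) PuiseuxSeries (pA i j)).
by apply/funext => i; apply/funext => j; rewrite /kmat mxE.
Qed.

Lemma pcoef_inj : injective (@pcoef R).
Proof. by move=> a b e; apply: puiseuxSeriesP => q; rewrite e. Qed.

Lemma kmat_inj : injective kmat.
Proof.
move=> M N e; apply/matrixP => i j; apply: pcoef_inj.
exact: (congr1 (fun A : Kmat R => A i j) e).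
Qed.

Lemma klin_kmat (l m : K) M N : klin l (kmat M) m (kmat N) = kmat (l *: M + m *: N).
Proof. by apply/funext => i; apply/funext => j; rewrite /kmat !mxE. Qed.

Lemma kscale_kmat (c : K) M : kscale c (kmat M) = kmat (c *: M).
Proof. by apply/funext => i; apply/funext => j; rewrite /kmat !mxE. Qed.

Lemma kmat_zeroP M : kmat_zero (kmat M) <-> M = 0.
Proof.
split=> [h|-> i j]; last by rewrite /kmat mxE.
by apply/matrixP => i j; rewrite mxE; apply: pcoef_inj; apply: h.
Qed.

Lemma kdet_kmat M : kdet (kmat M) = \det M.
Proof. by rewrite det_mx22. Qed.

Lemma klineP M N A : kline (kmat M) (kmat N) A <->
  exists l m : K, A = kmat (l *: M + m *: N) /\ l *: M + m *: N != 0.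
Proof.
split.
  move=> [[l [m [pl [pm ->]]]] nz]; exists (PuiseuxSeries pl), (PuiseuxSeries pm).
  rewrite -klin_kmat; split=> //; apply/eqP => e; apply: nz.
  by rewrite -[l]/(pcoef (PuiseuxSeries pl)) -[m]/(pcoef (PuiseuxSeries pm)) klin_kmat; apply/kmat_zeroP.
move=> [l [m [-> nz]]]; split; last by move=> /kmat_zeroP/eqP; rewrite (negPf nz).
by exists l, m; rewrite klin_kmat; split; [|split] => //; apply: pcoefP.
Qed.

Lemma kpropP M N : kprop (kmat M) (kmat N) <-> exists c : K, c != 0 /\ N = c *: M.
Proof.
split=> [[c [pc [c0 h]]]|[c [c0 ->]]].
  exists (PuiseuxSeries pc); split; first by apply/eqP => /(congr1 (@pcoef R)).
  by apply: kmat_inj; rewrite -kscale_kmat; apply/funext => i; apply/funext => j; rewrite h.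
exists c; split; first exact: pcoefP.
by split=> [/(@pcoef_inj _ 0)/eqP|i j]; [rewrite (negPf c0) | rewrite /kmat mxE].
Qed.

Lemma lead_dataP M alpha B :
  lead_data (kmat M) alpha B <-> [/\ B != 0, B = cf alpha M & mvle alpha M].
Proof.
split=> [[B0 [BM lM]]|[B0 e lM]]; last rewrite e in B0 *.
  by split=> //; apply/matrixP => i j; rewrite mxE BM.
by split=> //; split=> [i j|]; [rewrite mxE | exact: lM].
Qed.

(** The matrix by which VAL and the cones are defined; at [a = 0] it is the one defining the
    spherical coamoeba map. *)
Definition conevec (a : R) (Y : 'M[C]_2) :=
  (expR a)%:C *: Y + (expR (- a))%:C *: cstar (matc Y).

Lemma val_relP M X : val_rel (kmat M) X <->
  (\det M = 0 /\ exists alpha, [/\ mvle alpha M, cf alpha M != 0 & cprop (cf alpha M) X]) \/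
  (exists c : K, c ^+ 2 * \det M = 1 /\ exists alpha,
     [/\ mvle alpha (c *: M), cf alpha (c *: M) != 0 &
         cprop (conevec (ratr alpha) (cf alpha (c *: M))) X]).
Proof.
have det0 N : kdet (kmat N) = kzero R <-> \det N = 0.
  by rewrite kdet_kmat; split=> [/(@pcoef_inj _ 0)|->].
split.
- case=> [[/det0 dM [alpha [B [/lead_dataP[B0 eB lM] BX]]]]|].
    by left; split=> //; exists alpha; split; rewrite -?eB.
  move=> [_ [c [alpha [B [pc [cM [+ BX]]]]]]].
  rewrite -[c]/(pcoef (PuiseuxSeries pc)) in cM *.
  rewrite kscale_kmat => /lead_dataP[B0 eB lM]; right; exists (PuiseuxSeries pc); split.
    by apply: pcoef_inj; rewrite -[RHS]cM kdet_kmat.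
  by exists alpha; split; rewrite -?eB.
- case=> [[dM [alpha [lM B0 BX]]]|[c [cM [alpha [lM B0 BX]]]]].
    left; split; first exact/det0.
    by exists alpha, (cf alpha M); split=> //; apply/lead_dataP.
  right; split.
    by move=> /det0 dM; move/eqP: cM; rewrite dM mulr0 eq_sym oner_eq0.
  exists c, alpha, (cf alpha (c *: M)); split; first exact: pcoefP.
  split; first by rewrite kdet_kmat -[kone R]/(pcoef (1 : K)) -cM.
  by rewrite kscale_kmat; split=> //; apply/lead_dataP.
Qed.

Lemma cprop_scale (z : C) B X : z != 0 -> cprop (z *: B) X <-> cprop B X.
Proof.
move=> z0; split=> -[w [w0 ->]].
  by exists (w * z); rewrite mulf_neq0 // scalerA.
by exists (w / z); rewrite mulf_neq0 ?invr_eq0 // scalerA divfK.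
Qed.

(** Two distinct points span the line, so the two intersection points serve as a basis; scaling the
    second normalizes the polar form, once it is known to be nonzero. *)
Lemma line_basis (A1 A2 : Kmat R) : kindep A1 A2 -> meets_Q_in_two A1 A2 ->
  exists P P' : 'M[K]_2,
    [/\ \det P = 0, \det P' = 0, mpolar P P' = 1 &
      forall A, kline A1 A2 A <->
        exists l m : K, A = kmat (l *: P + m *: P') /\ l *: P + m *: P' != 0].
Proof.
move=> [/kmatP[M1 ->] [/kmatP[M2 ->] _]] [_ [_ [/klineP[l1 [m1 [-> a0]]]
  [/klineP[l2 [m2 [-> b0]]] [da [db [nab only]]]]]]].
set Pa := l1 *: M1 + m1 *: M2 in a0 da nab only.
set Pb := l2 *: M1 + m2 *: M2 in b0 db nab only.
have {}da : \det Pa = 0 by apply: pcoef_inj; rewrite -kdet_kmat.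
have {}db : \det Pb = 0 by apply: pcoef_inj; rewrite -kdet_kmat.
have {}nab (c : K) : Pb <> c *: Pa.
  move=> e; apply: nab; apply/kpropP; exists c; split=> //.
  by apply: contraNneq b0; rewrite e => ->; rewrite scale0r.
(* The determinant of the change of basis; if it vanished, the two points would coincide. *)
pose dl := l1 * m2 - l2 * m1.
have dl0 : dl != 0.
  apply/eqP => /eqP; rewrite subr_eq0 => /eqP e; have [l10|l10] := eqVneq l1 0.
    have m10 : m1 != 0.
      by apply: contraNneq a0 => m10; rewrite /Pa l10 m10 !scale0r addr0.
    have l20 : l2 = 0.
      by move/esym/eqP: e; rewrite l10 mul0r mulf_eq0 (negPf m10) orbF => /eqP.
    apply: (nab (m2 / m1)).
    by rewrite /Pa /Pb l10 l20 !scale0r !add0r scalerA divfK.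
  apply: (nab (l2 / l1)); rewrite /Pa /Pb scalerDr !scalerA divfK //.
  by rewrite mulrAC -e mulrAC mulfV // mul1r.
have lineE l m : l *: M1 + m *: M2 =
    ((l * m2 - m * l2) / dl) *: Pa + ((m * l1 - l * m1) / dl) *: Pb.
  by apply/matrixP => i j; rewrite !mxE; move: dl0; rewrite /dl => ?; field.
have inL l m : kline (kmat M1) (kmat M2) (kmat (l *: Pa + m *: Pb)) <->
    l *: Pa + m *: Pb != 0.
  have -> : l *: Pa + m *: Pb = (l * l1 + m * l2) *: M1 + (l * m1 + m * m2) *: M2.
    by apply/matrixP => i j; rewrite !mxE; ring.
  split; first by move=> /klineP[l' [m' [/kmat_inj <-]]].
  by move=> nz; apply/klineP; exists (l * l1 + m * l2), (l * m1 + m * m2).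
(* Otherwise the sum of the two points would be a third intersection point with the quadric. *)
have D0 : mpolar Pa Pb != 0.
  apply/eqP => D0; have nz : 1 *: Pa + 1 *: Pb != 0.
    apply/eqP; rewrite !scale1r => /eqP; rewrite addrC addr_eq0 => /eqP e.
    by apply: (nab (- 1)); rewrite scaleN1r.
  case: (only (kmat (1 *: Pa + 1 *: Pb))).
  - exact/inL.
  - by rewrite kdet_kmat det_lin da db D0 !mulr0 !addr0.
  - move=> /kpropP[c [_ e]]; apply: (nab (c - 1)).
    by rewrite scalerBl -e !scale1r addrAC subrr add0r.
  - move=> /kpropP[c [c0 e]]; have e' : Pa = (c - 1) *: Pb.
      by rewrite scalerBl -e !scale1r addrK.
    have c1 : c - 1 != 0.
      by apply: contraNneq a0 => c1; rewrite e' c1 scale0r.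
    by apply: (nab (c - 1)^-1); rewrite e' scalerA mulVf // scale1r.
exists Pa, ((mpolar Pa Pb)^-1 *: Pb); split=> //.
- by rewrite det_scale2 db mulr0.
- by rewrite mpolarZr mulVf.
move=> A; split.
  move=> /klineP[l [m [-> nz]]]; rewrite lineE in nz *.
  exists ((l * m2 - m * l2) / dl), ((m * l1 - l * m1) / dl * mpolar Pa Pb).
  by rewrite scalerA mulfK.
by move=> [l [m []]]; rewrite scalerA => -> ?; apply/inL.
Qed.

(* Rescaling (P, P') to (g P, g^-1 P') keeps mpolar P P' = 1 and lets us
   equalize the two valuations. *)
Lemma VALline_unit_lead (A1 A2 : Kmat R) : kindep A1 A2 -> meets_Q_in_two A1 A2 ->
  exists (P P' : 'M[K]_2) (r : rat),
    [/\ \det P = 0, \det P' = 0 & mpolar P P' = 1] /\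
    [/\ mvle r P, mvle r P', cf r P != 0 & cf r P' != 0] /\
    forall X, VALline A1 A2 X <->
      pts (cf r P) (cf r P') X \/
      exists alpha Y, unit_lead P P' alpha Y /\ cprop (conevec (ratr alpha) Y) X.
Proof.
move=> ind two; have [P0 [P0' [d0 d0' pol0 line0]]] := line_basis ind two.
have P0n : P0 != 0.
  by apply: contra_eq_neq pol0 => ->; rewrite -(scale0r 0) mpolarZl mul0r eq_sym oner_neq0.
have P0n' : P0' != 0.
  by apply: contra_eq_neq pol0 => ->; rewrite -(scale0r 0) mpolarZr mul0r eq_sym oner_neq0.
have [a [aP Pa]] := matrix_lead P0n; have [b [bP Pb]] := matrix_lead P0n'.
(* This exponent moves both valuations a and b to their mean r. *)
pose g : K := pmono 1 ((b - a) / 2).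
pose g' : K := pmono 1 (- ((b - a) / 2)).
have gg : g * g' = 1 by rewrite /g /g' pmonoM mulr1 subrr pmono1.
have g0 : g != 0 by apply: contra_eq_neq gg => ->; rewrite mul0r eq_sym oner_neq0.
have g'0 : g' != 0 by apply: contra_eq_neq gg => ->; rewrite mulr0 eq_sym oner_neq0.
pose r := (a + b) / 2; pose P := g *: P0; pose P' := g' *: P0'.
have vg : vle ((b - a) / 2) g by exact: vle_mono.
have vg' : vle (- ((b - a) / 2)) g' by exact: vle_mono.
have r1 : r = (b - a) / 2 + a by rewrite /r; lra.
have r2 : r = - ((b - a) / 2) + b by rewrite /r; lra.
have rP : mvle r P by rewrite r1; apply: mvleZ.
have rP' : mvle r P' by rewrite r2; apply: mvleZ.
have cP : cf r P != 0 by rewrite r1 cfZ // mono_coef scale1r.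
have cP' : cf r P' != 0 by rewrite r2 cfZ // mono_coef scale1r.
have line A : kline A1 A2 A <->
    exists l m : K, A = kmat (l *: P + m *: P') /\ l *: P + m *: P' != 0.
  apply: (iff_trans (line0 A)); split=> -[l [m [-> nz]]].
    exists (l * g'), (m * g); rewrite /P /P' !scalerA.
    by rewrite -!mulrA gg [g' * g]mulrC gg !mulr1.
  by exists (l * g), (m * g'); rewrite -!scalerA.
have dP : \det P = 0 by rewrite det_scale2 d0 mulr0.
have dP' : \det P' = 0 by rewrite det_scale2 d0' mulr0.
have pol : mpolar P P' = 1 by rewrite mpolarZl mpolarZr mulrA gg mul1r.
have dL l m : \det (l *: P + m *: P') = l * m.
  by rewrite det_lin dP dP' pol !mulr0 !add0r mulr1.
exists P, P', r; split=> //; split=> // X; clearbody P P' r.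
have lead_scale l N alpha : mvle r N -> cf r N != 0 -> l *: N != 0 ->
    mvle alpha (l *: N) -> cf alpha (l *: N) != 0 -> cprop (cf alpha (l *: N)) X ->
    cprop (cf r N) X.
  move=> rN Nr lN aN Na; have l0 : l != 0 by apply: contraNneq lN => ->; rewrite scale0r.
  have [v [vl lv]] := series_lead l0; have cN := cfZ vl rN.
  have -> : alpha = v + r.
    apply: (mvle_unique aN Na); first exact: mvleZ.
    by rewrite cN scaler_eq0 negb_or lv.
  by rewrite cN cprop_scale.
split.
- move=> [_ [/line[l [m [-> nz]]] /val_relP]]; rewrite dL.
  case=> [[/eqP lm [alpha a0]]|[c [cl [alpha a0]]]].
    move: lm; rewrite mulf_eq0 => /orP[]/eqP e; left; move: nz a0; rewrite e scale0r ?add0r ?addr0.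
      by move=> nz [aN Na NX]; right; apply: lead_scale NX.
    by move=> nz [aN Na NX]; left; apply: lead_scale NX.
  right; exists alpha; have cl0 : c * l != 0.
    by apply: contra_eq_neq cl => e; rewrite expr2 -!mulrA [c * (l * m)]mulrA e mul0r mulr0 eq_sym oner_neq0.
  (* The normalization c^2 l m = 1 says that c m is the inverse of c l. *)
  move: a0; have -> : c *: (l *: P + m *: P') = (c * l) *: P + (c * l)^-1 *: P'.
    have <- : c * m = (c * l)^-1.
      by apply: (mulfI cl0); rewrite (mulfV cl0) mulrACA -expr2.
    by rewrite scalerDr 2!scalerA.
  set N := _ + _; move=> [aN Na NX]; exists (cf alpha N); split=> //.
  by exists (c * l).
- case=> [[h|h]|[alpha [Y [[l [l0 [aN [-> Na]]]] h]]]].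
  + exists (kmat P); split.
      apply/line; exists 1, 0; rewrite scale1r scale0r addr0; split=> //.
      apply: contraNneq cP => ->; apply/eqP/matrixP => i j; rewrite !mxE //.
    by apply/val_relP; left; split=> //; exists r.
  + exists (kmat P'); split.
      apply/line; exists 0, 1; rewrite scale1r scale0r add0r; split=> //.
      apply: contraNneq cP' => ->; apply/eqP/matrixP => i j; rewrite !mxE //.
    by apply/val_relP; left; split=> //; exists r.
  + exists (kmat (l *: P + l^-1 *: P')); split.
      apply/line; exists l, l^-1; split=> //.
      apply: contraNneq Na => ->; apply/eqP/matrixP => i j; rewrite !mxE //.
    apply/val_relP; right; exists 1; rewrite expr1n mul1r dL mulfV //; split=> //.
    by exists alpha; rewrite scale1r.
Qed.
End Reduction.

(** * Continuity of the section *)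

Section Continuity.
Variable R : realType.
Local Notation C := (R[i]).
Import Normc.
Implicit Types (x y z w : C) (B U V : 'M[C]_2).

Lemma normc_ge0 z : 0 <= normc z.
Proof. by case: z => a b; exact: sqrtr_ge0. Qed.

Lemma normc_gt0 z : z != 0 -> 0 < normc z.
Proof.
by move=> z0; rewrite lt_def normc_ge0 andbT; apply: contraNneq z0 => /eq0_normc ->.
Qed.

Lemma normc_real (r : R) : normc r%:C = `|r|.
Proof. by rewrite /= expr0n addr0 sqrtr_sqr. Qed.

Lemma normc_sqr z : normc z ^+ 2 = complex.Re z ^+ 2 + complex.Im z ^+ 2.
Proof. by case: z => a b /=; rewrite sqr_sqrtr // addr_ge0 ?sqr_ge0. Qed.

Lemma normcB z w : normc (z - w) = normc (w - z).
Proof. by rewrite -normcN opprB. Qed.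

Lemma le_normcB z w : `|normc z - normc w| <= normc (z - w).
Proof.
rewrite ler_norml; apply/andP; split.
  have := le_normcD (w - z) z; rewrite subrK [normc (w - z)]normcB => h; lra.
by have := le_normcD (z - w) w; rewrite subrK => h; lra.
Qed.

Lemma mnorm2E B : mnorm2 B = \sum_(i < 2) \sum_(j < 2) normc (B i j) ^+ 2.
Proof. by apply: eq_bigr => i _; apply: eq_bigr => j _; rewrite normc_sqr. Qed.

Lemma mnorm2_ge B i j : normc (B i j) ^+ 2 <= mnorm2 B.
Proof.
rewrite mnorm2E (bigD1 i) //= (bigD1 j) //= -addrA lerDl addr_ge0 //.
  by apply: sumr_ge0 => k _; exact: sqr_ge0.
by apply: sumr_ge0 => k _; apply: sumr_ge0 => m _; exact: sqr_ge0.
Qed.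

Lemma mnorm2_ge0 B : 0 <= mnorm2 B.
Proof. by apply: le_trans (sqr_ge0 _) (mnorm2_ge B ord0 ord0). Qed.

Lemma mnorm2Z z B : mnorm2 (z *: B) = normc z ^+ 2 * mnorm2 B.
Proof.
rewrite !mnorm2E mulr_sumr; apply: eq_bigr => i _; rewrite mulr_sumr.
by apply: eq_bigr => j _; rewrite mxE normcM exprMn.
Qed.

Lemma mnorm2D U V : mnorm2 (U + V) <= 2 * mnorm2 U + 2 * mnorm2 V.
Proof.
rewrite !mnorm2E !mulr_sumr -big_split; apply: ler_sum => i _.
rewrite !mulr_sumr -big_split; apply: ler_sum => j _ /=; rewrite mxE.
have h := le_normcD (U i j) (V i j).
apply: (@le_trans _ _ ((normc (U i j) + normc (V i j)) ^+ 2)).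
  by rewrite ler_sqr ?nnegrE ?addr_ge0 ?normc_ge0.
rewrite -subr_ge0; have -> : forall a b : R, 2 * a ^+ 2 + 2 * b ^+ 2 - (a + b) ^+ 2 = (a - b) ^+ 2.
  by move=> a b; ring.
exact: sqr_ge0.
Qed.

Lemma mnorm2_gt0 B : B != 0 -> 0 < mnorm2 B.
Proof.
move=> B0; rewrite lt_def mnorm2_ge0 andbT; apply: contraNneq B0 => e.
apply/eqP/matrixP => i j; rewrite mxE; apply: eq0_normc; apply/eqP.
have := mnorm2_ge B i j; rewrite e => h.
by rewrite -sqrf_eq0 eq_le h sqr_ge0.
Qed.

(** Division by a nonzero [z] is, up to a positive real factor, multiplication by this number of
    modulus 1. *)
Definition phase z : C := (normc z)%:C / z.

Lemma normc_phase z : z != 0 -> normc (phase z) = 1.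
Proof.
move=> z0; rewrite normcM normcV normc_real ger0_norm ?normc_ge0 // mulfV //.
by rewrite gt_eqF // normc_gt0.
Qed.

(** After multiplication by |w| this is the triangle inequality for |z| w - |w| z = (|z| - |w|) w +
    |w| (w - z). *)
Lemma phase_lipschitz z w : z != 0 -> w != 0 ->
  normc (phase z - phase w) * normc z <= 2 * normc (z - w).
Proof.
move=> z0 w0; have nw := normc_gt0 w0; rewrite -(ler_pM2r nw) -mulrA -!normcM.
have -> : (phase z - phase w) * (z * w) =
    ((normc z)%:C - (normc w)%:C) * w + (normc w)%:C * (w - z).
  by rewrite /phase; field; apply/andP.
apply: le_trans (le_normcD _ _) _; rewrite !normcM normc_real (ger0_norm (normc_ge0 w)).
have -> : (normc z)%:C - (normc w)%:C = (normc z - normc w)%:C by rewrite rmorphB.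
rewrite normc_real [normc (w - z)]normcB [_ w * _]mulrC -mulrDl ler_pM2r //.
by have := le_normcB z w; lra.
Qed.

(* A square root of z^2 is determined up to sign, and it depends continuously
   on z^2 once the sign is chosen well. *)
Lemma phase_close z w : z != 0 -> w != 0 ->
  exists s : R, s ^+ 2 = 1 /\
    normc (phase z - s%:C * phase w) ^+ 2 * normc z ^+ 2 <= 4 * normc (z ^+ 2 - w ^+ 2).
Proof.
move=> z0 w0.
have [s [s1 hs]] : exists s : R, s ^+ 2 = 1 /\
    normc (z - s%:C * w) ^+ 2 <= normc (z ^+ 2 - w ^+ 2).
  (* The sign makes z - s w the smaller factor of z^2 - w^2 = (z - w)(z + w), so its square is at
     most the product. *)
  rewrite subr_sqr normcM; have [le|/ltW le] := leP (normc (z - w)) (normc (z + w)).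
    by exists 1; rewrite expr1n mul1r expr2 ler_wpM2l ?normc_ge0.
  exists (-1); rewrite sqrrN expr1n rmorphN mulN1r opprK expr2; split=> //.
  by rewrite ler_wpM2r ?normc_ge0.
have sn0 : s%:C != 0 :> C.
  by rewrite -[0]/(0%:C) (inj_eq (@complexI R)) -sqrf_eq0 s1 oner_eq0.
have ns : normc s%:C = 1 :> R.
  apply/eqP; rewrite -(@eqrXn2 _ 2) ?normc_ge0 // expr1n normc_real.
  by rewrite real_normK ?num_real // s1.
exists s; split=> //.
have <- : phase (s%:C * w) = s%:C * phase w.
  rewrite /phase normcM ns mul1r invfM mulrCA.
  congr (_ * _); apply: (mulfI sn0); rewrite mulfV // -expr2 -rmorphXn s1.
  by rewrite rmorph1.
have h := @phase_lipschitz z (s%:C * w) z0 (mulf_neq0 sn0 w0).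
apply: (@le_trans _ _ ((2 * normc (z - s%:C * w)) ^+ 2)).
  by rewrite -exprMn ler_sqr ?nnegrE ?mulr_ge0 ?normc_ge0.
by rewrite exprMn -natrX ler_wpM2l.
Qed.

Definition lform (a M : 'M[C]_2) : C := \sum_(i < 2) \sum_(j < 2) a i j * M i j.

Lemma lformZ a x M : lform a (x *: M) = x * lform a M.
Proof.
rewrite mulr_sumr; apply: eq_bigr => i _; rewrite mulr_sumr.
by apply: eq_bigr => j _; rewrite mxE mulrCA.
Qed.

Lemma lformD a M N : lform a (M + N) = lform a M + lform a N.
Proof.
rewrite -big_split; apply: eq_bigr => i _; rewrite -big_split.
by apply: eq_bigr => j _; rewrite mxE mulrDr.
Qed.

Lemma lformB a M N : lform a (M - N) = lform a M - lform a N.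
Proof. by rewrite lformD -scaleN1r lformZ mulN1r. Qed.

Lemma lformZl a x M : lform (x *: a) M = x * lform a M.
Proof.
rewrite mulr_sumr; apply: eq_bigr => i _; rewrite mulr_sumr.
by apply: eq_bigr => j _; rewrite mxE mulrA.
Qed.

Lemma lformDl a b M : lform (a + b) M = lform a M + lform b M.
Proof.
rewrite -big_split; apply: eq_bigr => i _; rewrite -big_split.
by apply: eq_bigr => j _; rewrite mxE mulrDl.
Qed.

Lemma lform_delta i j M : lform (delta_mx i j) M = M i j.
Proof.
rewrite /lform (bigD1 i) //= (bigD1 j) //= mxE !eqxx mul1r !big1 ?addr0 //.
  by move=> k ki; rewrite big1 // => m _; rewrite mxE (negPf ki) mul0r.
by move=> m mj; rewrite mxE (negPf mj) andbF mul0r.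
Qed.

Lemma lform_bound a : exists k : R, 0 < k /\ forall M (t : R), 0 <= t ->
  mnorm2 M <= t ^+ 2 -> normc (lform a M) <= k * t.
Proof.
pose k : R := \sum_(i < 2) \sum_(j < 2) normc (a i j).
have k0 : 0 <= k by apply: sumr_ge0 => i _; apply: sumr_ge0 => j _; exact: normc_ge0.
exists (k + 1); split; first by rewrite ltr_wpDl.
move=> M t t0 hM; apply: (@le_trans _ _ (k * t)); last by rewrite ler_wpM2r // lerDl.
have nsum (F : 'I_2 -> C) : normc (\sum_(i < 2) F i) <= \sum_(i < 2) normc (F i).
  by rewrite !big_ord_recl !big_ord0 !addr0; exact: le_normcD.
rewrite mulr_suml; apply: le_trans (nsum _) _; apply: ler_sum => i _.
rewrite mulr_suml; apply: le_trans (nsum _) _; apply: ler_sum => j _.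
rewrite normcM ler_wpM2l ?normc_ge0 // -ler_sqr ?nnegrE ?normc_ge0 //.
exact: le_trans (mnorm2_ge M i j) hM.
Qed.

Lemma small_factor (Q e : R) : 0 < Q -> 0 < e -> exists t : R, [/\ 0 < t, t <= 1 & t * Q < e].
Proof.
move=> Q0 e0; exists (Num.min 1 (e / (2 * Q))).
have h : 0 < e / (2 * Q) by rewrite divr_gt0 // mulr_gt0.
split; first by rewrite lt_min ltr01.
  by rewrite ge_min lexx.
apply: (@le_lt_trans _ _ (e / (2 * Q) * Q)).
  by rewrite ler_wpM2r ?(ltW Q0) // ge_min lexx orbT.
have -> : e / (2 * Q) * Q = e / 2 by field; rewrite gt_eqF.
by rewrite ltr_pdivrMr // ltr_pMr // ltr1n.
Qed.

(** The form under the root is homogeneous of degree 2, so where it is nonzero, scaling [M] by a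
    nonzero complex number changes the result at most by a sign: the class modulo nonzero reals
    depends only on the projective point. *)
Definition normalize (a b M : 'M[C]_2) : 'M[C]_2 :=
  (sqrtc (lform a M * lform b M))^-1 *: M.

(** For continuity, nearby representatives of norm 1 have nearby values of the quadratic form, hence
    by [phase_close] nearby phases up to a sign, and this sign is absorbed by the real scalars. *)
Lemma section_normalize (a b : 'M[C]_2) (Z : set 'M[C]_2) :
  (forall M, Z M -> [/\ M != 0, \det M = 0 & lform a M * lform b M != 0]) ->
  section (normalize a b) Z.
Proof.
move=> hZ; pose phi M := lform a M * lform b M.
pose rho M := sqrtc (phi M).
have rho2 M : rho M ^+ 2 = phi M by rewrite sqr_sqrtc.
have rho0 M : Z M -> rho M != 0.
  by move=> /hZ[_ _ h]; rewrite -sqrf_eq0 rho2.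
have phiZ z M : phi (z *: M) = z ^+ 2 * phi M by rewrite /phi !lformZ; ring.
split; last split.
- move=> B ZB; have [B0 dB _] := hZ B ZB; have r0 := rho0 B ZB.
  split; first by rewrite scaler_eq0 negb_or invr_eq0 r0.
  split; first by rewrite det_scale2 dB mulr0.
  by exists (rho B)^-1; rewrite invr_eq0.
- move=> B z ZB z0; have r0 := rho0 B ZB.
  have /eqP : (rho (z *: B)) ^+ 2 = (z * rho B) ^+ 2 by rewrite exprMn !rho2 phiZ.
  rewrite eqf_sqr /normalize -/(phi B) -/(phi (z *: B)) -/(rho B) -/(rho (z *: B)).
  case/orP => /eqP ->.
    exists 1; rewrite oner_neq0 scale1r scalerA; split=> //.
    by congr (_ *: _); field; apply/andP.
  exists (-1); rewrite oppr_eq0 oner_neq0 !scalerA; split=> //.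
  by congr (_ *: _); rewrite rmorphN1; field; apply/andP.
move=> B e ZB e0; have [B0 _ phiB] := hZ B ZB.
have nB := mnorm2_gt0 B0.
(* The modulus of the quadratic form on a representative of [B] of norm 1. *)
pose m := normc (phi B) / mnorm2 B.
have m0 : 0 < m by rewrite divr_gt0 // normc_gt0.
have [ka [ka0 hka]] := lform_bound a; have [kb [kb0 hkb]] := lform_bound b.
(* With squared distance below t^2 <= t between the representatives, the final estimate is t times
   this constant. *)
have [|t [t0 t1 tQ]] := @small_factor (2 + 16 * ka * kb / m) e _ e0.
  have : 0 < 16 * ka * kb / m by rewrite divr_gt0 // !mulr_gt0.
  by lra.
exists (t ^+ 2); split; first by rewrite exprn_gt0.
move=> B' ZB' [z [w [Nz [Nw Nzw]]]].
have z0 : z != 0.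
  by apply: contra_eq_neq Nz => ->; rewrite mnorm2Z normc0 expr0n mul0r eq_sym oner_neq0.
have w0 : w != 0.
  by apply: contra_eq_neq Nw => ->; rewrite mnorm2Z normc0 expr0n mul0r eq_sym oner_neq0.
pose p := z * rho B; pose q := w * rho B'.
have p0 : p != 0 by rewrite mulf_neq0 ?rho0.
have q0 : q != 0 by rewrite mulf_neq0 ?rho0.
have [s [s1 hs]] := phase_close p0 q0.
have np : normc p ^+ 2 = m.
  have nB' : mnorm2 B != 0 by rewrite gt_eqF.
  have Nz' : normc z ^+ 2 = (mnorm2 B)^-1.
    by apply: (mulIf nB'); rewrite -mnorm2Z Nz mulVf.
  have -> : normc p ^+ 2 = normc (z ^+ 2 * phi B).
    by rewrite -rho2 -exprMn [in RHS]expr2 [RHS]normcM -expr2.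
  by rewrite normcM expr2 normcM -expr2 Nz' mulrC.
have phase_s M v : Z M -> v != 0 ->
    (normc (v * rho M))%:C *: normalize a b M = phase (v * rho M) *: (v *: M).
  move=> ZM v0; have rM := rho0 M ZM; rewrite /normalize /phase !scalerA -/(phi M) -/(rho M).
  by congr (_ *: _); field; apply/andP.
have nsq (c : R) : c ^+ 2 = 1 -> normc c%:C ^+ 2 = 1.
  by move=> c1; rewrite normc_real real_normK ?num_real.
(* These real factors turn the values of the section into unimodular multiples of the norm 1
   representatives. *)
exists (normc p), (s * normc q).
rewrite rmorphM -[(s%:C * _) *: _]scalerA !phase_s // -/p -/q.
split; first by rewrite mnorm2Z normc_phase // expr1n mul1r.
split; first by rewrite !mnorm2Z nsq // normc_phase // expr1n !mul1r -mnorm2Z.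
have -> : phase p *: (z *: B) - s%:C *: (phase q *: (w *: B')) =
    phase p *: (z *: B - w *: B') + (phase p - s%:C * phase q) *: (w *: B').
  rewrite [s%:C *: _]scalerA scalerBr scalerBl.
  by rewrite addrA subrK.
apply: le_lt_trans (mnorm2D _ _) _.
rewrite [X in 2 * X + _]mnorm2Z [X in _ + 2 * X]mnorm2Z Nw.
rewrite normc_phase // expr1n mul1r mulr1.
have heta : normc (p ^+ 2 - q ^+ 2) <= 2 * ka * kb * t.
  rewrite !exprMn !rho2 -!phiZ /phi.
  set U := z *: B; set V := w *: B'.
  have -> : lform a U * lform b U - lform a V * lform b V =
      lform a (U - V) * lform b U + lform a V * lform b (U - V).
    by rewrite !lformB; ring.
  apply: le_trans (le_normcD _ _) _; rewrite !normcM.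
  have aD := hka (U - V) t (ltW t0) (ltW Nzw).
  have bD := hkb (U - V) t (ltW t0) (ltW Nzw).
  have bU : normc (lform b U) <= kb by rewrite -[kb]mulr1; apply: hkb; rewrite ?Nz ?expr1n.
  have aV : normc (lform a V) <= ka by rewrite -[ka]mulr1; apply: hka; rewrite ?Nw ?expr1n.
  have h1 := ler_pM (normc_ge0 _) (normc_ge0 _) aD bU.
  have h2 := ler_pM (normc_ge0 _) (normc_ge0 _) aV bD.
  have -> : 2 * ka * kb * t = ka * t * kb + ka * (kb * t) by ring.
  exact: lerD.
rewrite np in hs.
have hs' : normc (phase p - s%:C * phase q) ^+ 2 <= 8 * ka * kb / m * t.
  rewrite -(ler_pM2r m0); apply: le_trans hs _.
  have -> : 8 * ka * kb / m * t * m = 4 * (2 * ka * kb * t) by field; rewrite gt_eqF.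
  by rewrite ler_wpM2l.
have tt : t ^+ 2 <= t by rewrite expr2 ler_piMl // ltW.
apply: le_lt_trans tQ.
have -> : t * (2 + 16 * ka * kb / m) = 2 * t + 2 * (8 * ka * kb / m * t) by field; rewrite gt_eqF.
apply: lerD; rewrite ler_pM2l //.
exact: le_trans (ltW Nzw) tt.
Qed.

End Continuity.

(** * The four cases *)

Section Assembly.
Variable R : realType.
Local Notation C := (R[i]).
Local Notation K := (puiseuxSeries R).
Implicit Types (B D U V X Y : 'M[C]_2).

Lemma matrix_entry (F : pzRingType) (M : 'M[F]_2) : M != 0 -> exists i j, M i j != 0.
Proof.
move=> M0; apply: contrapT => h; move/eqP: M0; apply; apply/matrixP => i j.
by rewrite mxE; apply/eqP; apply: contrapT => /negP ?; apply: h; exists i, j.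
Qed.

(** These functionals read off the coordinates on the line through [U] and [V], from which the
    section is built. *)
Lemma dual_forms U V : cindep U V -> exists a b,
  [/\ lform a U = 1, lform a V = 0, lform b U = 0 & lform b V = 1].
Proof.
move=> ind; have [i [j Uij]] := matrix_entry (cindep_neq0l ind).
have [k [l]] : exists k l, ((- (V i j / U i j)) *: U + 1 *: V) k l != 0.
  by apply: matrix_entry; apply: cindep_neq0 ind _; rewrite oner_neq0 orbT.
rewrite !mxE mul1r; set d := _ + _ => d0.
(* Gaussian elimination: the entry (i, j) is used to kill [U], and [d] is the value left on [V]. *)
pose b := d^-1 *: (delta_mx k l + (- (U k l / U i j)) *: delta_mx i j).
have bU : lform b U = 0.
  by rewrite lformZl lformDl lformZl !lform_delta mulNr divfK // subrr mulr0.
have bV : lform b V = 1.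
  rewrite lformZl lformDl lformZl !lform_delta -[RHS](mulVf d0); congr (_ * _).
  by rewrite /d; field.
exists ((U i j)^-1 *: (delta_mx i j + (- V i j) *: b)), b; split=> //.
  by rewrite lformZl lformDl lformZl lform_delta bU mulr0 addr0 mulVf.
by rewrite lformZl lformDl lformZl lform_delta bV mulr1 subrr mulr0.
Qed.

Lemma punctP B D M : cindep B D -> punct B D B D M <->
  exists x y, [/\ x != 0, y != 0 & M = x *: B + y *: D].
Proof.
move=> ind; split.
  move=> [[[x [y ->]] M0] [nB nD]]; exists x, y; split=> //.
    apply/eqP => x0; apply: nD; move: M0; rewrite x0 scale0r add0r => M0.
    by exists y; split=> //; apply: contraNneq M0 => ->; rewrite scale0r.
  apply/eqP => y0; apply: nB; move: M0; rewrite y0 scale0r addr0 => M0.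
  by exists x; split=> //; apply: contraNneq M0 => ->; rewrite scale0r.
move=> [x [y [x0 y0 ->]]]; split; last split.
- by split; [exists x, y | apply: cindep_neq0; rewrite ?x0].
- move=> [z [z0 e]]; have [] := ind (x - z) y; last by move=> _ /eqP; rewrite (negPf y0).
  by rewrite scalerBl addrAC e subrr.
- move=> [z [z0 e]]; have [] := ind x (y - z); last by move=> /eqP; rewrite (negPf x0).
  by rewrite scalerBl addrA e subrr.
Qed.

Lemma punct1P B D M : cindep B D -> punct B D B B M <->
  exists x y, y != 0 /\ M = x *: B + y *: D.
Proof.
move=> ind; split.
  move=> [[[x [y ->]] M0] [nB _]]; exists x, y; split=> //.
  apply/eqP => y0; apply: nB; move: M0; rewrite y0 scale0r addr0 => M0.
  by exists x; split=> //; apply: contraNneq M0 => ->; rewrite scale0r.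
move=> [x [y [y0 ->]]].
have nB : ~ cprop B (x *: B + y *: D).
  move=> [z [z0 e]]; have [] := ind (x - z) y; last by move=> _ /eqP; rewrite (negPf y0).
  by rewrite scalerBl addrAC e subrr.
by split=> //; split; [exists x, y | apply: cindep_neq0; rewrite ?y0 ?orbT].
Qed.

Lemma cline_l B D : cindep B D -> cline B D B.
Proof.
move=> ind; split; first by exists 1, 0; rewrite scale1r scale0r addr0.
exact: cindep_neq0l ind.
Qed.

Lemma cline_r B D : cindep B D -> cline B D D.
Proof.
move=> ind; split; first by exists 0, 1; rewrite scale1r scale0r add0r.
exact: cindep_neq0r ind.
Qed.

Lemma cindep_nprop B D : cindep B D -> ~ cprop B D.
Proof.
move=> ind [z [z0 e]]; have [] := ind z (-1); first by rewrite e scaleN1r subrr.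
by move=> /eqP; rewrite (negPf z0).
Qed.

Lemma det_cline0 B D : \det B = 0 -> \det D = 0 -> mpolar B D = 0 ->
  forall A, cline B D A -> \det A = 0.
Proof. by move=> dB dD pBD _ [[x [y ->]] _]; rewrite det_lin dB dD pBD !mulr0 !addr0. Qed.

Lemma conevec_real (a x : R) Y : conevec a (x%:C *: Y) = x%:C *: conevec a Y.
Proof.
rewrite /conevec; have -> : matc (x%:C *: Y) = x%:C *: matc Y.
  by apply/matrixP => i j; rewrite !mxE; case: ifP; rewrite // mulrN.
have -> : cstar (x%:C *: matc Y) = x%:C *: cstar (matc Y).
  by apply/matrixP => i j; rewrite !mxE rmorphM /= oppr0.
by rewrite scalerDr !scalerA ![_ * x%:C]mulrC.
Qed.

Lemma conevec0 Y : conevec 0 Y = Y + cstar (matc Y).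
Proof. by rewrite /conevec oppr0 expR0 !scale1r. Qed.

Lemma cprop_conevec_real (a x : R) Y X : x != 0 ->
  cprop (conevec a (x%:C *: Y)) X <-> cprop (conevec a Y) X.
Proof.
move=> x0; rewrite conevec_real; apply: cprop_scale.
by rewrite -[0]/(0%:C) (inj_eq (@complexI R)).
Qed.

Lemma cone_ratint (r : rat) B D X : B != 0 -> D != 0 -> \det B = 0 -> \det D = 0 ->
  cone (ratint (ratr r)) (Srestr B D) X <->
  exists alpha Y, [/\ r < alpha, exists c, c != 0 /\ (Y = c *: B \/ Y = c *: D) &
    cprop (conevec (ratr alpha) Y) X].
Proof.
move=> B0 D0 dB dD; split.
  move=> [a [Y [[ra [al ea]] [[Y0 [dY hY]] YX]]]]; rewrite {a}ea ltr_rat in ra YX.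
  exists al, Y; split=> //; case: hY => -[c [c0 ->]]; exists c; split=> //; by [left | right].
move=> [al [Y [ra [c [c0 hY]] YX]]]; exists (ratr al), Y; split.
  by split; [rewrite ltr_rat | exists al].
split=> //; split; first by case: hY => ->; rewrite scaler_eq0 negb_or c0.
split; first by case: hY => ->; rewrite det_scale2 ?dB ?dD mulr0.
by case: hY => ->; [left | right]; exists c.
Qed.

(** [T] describes the normalized matrices. A real factor does not move the cone point, so these
    alone give the whole image of the section. *)
Lemma cone_section (r : R) a b (Z : set 'M[C]_2) X (T : 'M[C]_2 -> Prop) :
  (forall M, Z M -> exists Y, T Y /\ normalize a b M = Y) ->
  (forall Y, T Y -> Z Y /\ normalize a b Y = Y) ->
  cone [set r] (sec_image (normalize a b) Z) X <->
  exists Y, T Y /\ cprop (conevec r Y) X.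
Proof.
move=> ZT TZ; split.
  move=> [_ [_ [-> [[M [/ZT[Y [TY ->]] [x [x0 ->]]]] h]]]].
  by exists Y; split=> //; apply/(cprop_conevec_real r Y X x0).
move=> [Y [TY h]]; have [ZY nY] := TZ _ TY.
exists r, Y; split=> //; split=> //; exists Y; split=> //.
by exists 1; rewrite nY oner_neq0 scale1r.
Qed.

(** On x B + y D the quadratic form is x y, and it equals 1 exactly when y = x^-1. *)
Lemma cone_section_iii (r : R) a b B D X : cindep B D ->
  lform a B = 1 -> lform a D = 0 -> lform b B = 0 -> lform b D = 1 ->
  cone [set r] (sec_image (normalize a b) (punct B D B D)) X <->
  exists Y, (exists c, c != 0 /\ Y = c *: B + c^-1 *: D) /\ cprop (conevec r Y) X.
Proof.
move=> ind aB aD bB bD; have aE x y : lform a (x *: B + y *: D) = x.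
  by rewrite lformD !lformZ aB aD mulr0 addr0 mulr1.
have bE x y : lform b (x *: B + y *: D) = y.
  by rewrite lformD !lformZ bB bD mulr0 add0r mulr1.
apply: cone_section => [M /(punctP _ ind)[x [y [x0 y0 ->]]]|_ [c [c0 ->]]]; last first.
  split; first by apply/(punctP _ ind); exists c, c^-1; rewrite invr_eq0.
  by rewrite /normalize aE bE mulfV // sqrtc1 invr1 scale1r.
rewrite /normalize aE bE; set w := sqrtc _.
have w2 : w ^+ 2 = x * y by rewrite sqr_sqrtc.
clearbody w; have w0 : w != 0 by rewrite -sqrf_eq0 w2 mulf_neq0.
exists ((x / w) *: B + (x / w)^-1 *: D); split.
  by exists (x / w); rewrite mulf_neq0 ?invr_eq0.
rewrite scalerDr !scalerA; congr (_ *: _ + _ *: _); first by rewrite mulrC.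
have -> : y = w ^+ 2 / x by rewrite w2 mulrAC mulfV // mul1r.
by field; apply/andP.
Qed.

(** On x B + y D the quadratic form is -k y^2, and it equals 1 exactly when y = c^-1 with c^2 =
    -k. *)
Lemma cone_section_i (r : R) b B D (k : C) X : cindep B D -> k != 0 ->
  lform b B = 0 -> lform b D = 1 ->
  cone [set r] (sec_image (normalize ((- k) *: b) b) (punct B D B B)) X <->
  exists Y, (exists x c, c ^+ 2 = - k /\ Y = x *: B + c^-1 *: D) /\
    cprop (conevec r Y) X.
Proof.
move=> ind k0 bB bD; have bE x y : lform b (x *: B + y *: D) = y.
  by rewrite lformD !lformZ bB bD mulr0 add0r mulr1.
apply: cone_section => [M /(punct1P _ ind)[x [y [y0 ->]]]|_ [x [c [ck ->]]]]; last first.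
  have c0 : c != 0 by rewrite -sqrf_eq0 ck oppr_eq0.
  split; first by apply/(punct1P _ ind); exists x, c^-1; rewrite invr_eq0.
  rewrite /normalize lformZl bE -ck; have -> : c ^+ 2 * c^-1 * c^-1 = 1 by field.
  by rewrite sqrtc1 invr1 scale1r.
rewrite /normalize lformZl bE; set w := sqrtc _.
have w2 : w ^+ 2 = - k * y * y by rewrite sqr_sqrtc.
clearbody w; have w0 : w != 0 by rewrite -sqrf_eq0 w2 !mulf_neq0 ?oppr_eq0.
exists ((x / w) *: B + (w / y)^-1 *: D); split.
  exists (x / w), (w / y); split=> //.
  by rewrite exprMn w2; field.
by rewrite scalerDr !scalerA invf_div [w^-1 * x]mulrC [w^-1 * y]mulrC.
Qed.

(** Common to cases (iii) and (iv), which differ in how the stratum at r is described. *)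
Lemma VALline_indep (A1 A2 : Kmat R) (P P' : 'M[K]_2) (r : rat) B B' :
  [/\ mvle r P, mvle r P', B = cf r P & B' = cf r P'] -> cindep B B' ->
  \det B = 0 -> \det B' = 0 ->
  (forall X, VALline A1 A2 X <-> pts B B' X \/
     exists alpha Y, unit_lead P P' alpha Y /\ cprop (conevec (ratr alpha) Y) X) ->
  forall X, VALline A1 A2 X <->
    ((exists Y, (exists c, c != 0 /\ Y = c *: B + c^-1 *: B') /\
       cprop (conevec (ratr r) Y) X) \/
     cone (ratint (ratr r)) (Srestr B B') X) \/ pts B B' X.
Proof.
move=> [rP rP' eB eB'] ind dB dB' hV X.
have [_ B0] := cline_l ind; have [_ B'0] := cline_r ind.
have uP al Y := unit_lead_indep al Y rP rP' eB eB' ind.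
have hc := cone_ratint r X B0 B'0 dB dB'.
split.
  move=> /hV[?|[al [Y [/uP[[ra hY]|[-> hY]] YX]]]]; first by right.
    by left; right; apply/hc; exists al, Y.
  by left; left; exists Y.
case=> [[[Y [hY YX]]|/hc[al [Y [ra hY YX]]]]|?]; apply/hV; last by left.
  by right; exists r, Y; split=> //; apply/uP; right.
by right; exists al, Y; split=> //; apply/uP; left.
Qed.

(** Common to cases (i) and (ii); the two points at infinity coincide because [B'] is a multiple of
    [B]. *)
Lemma VALline_dep (A1 A2 : Kmat R) (P P' E : 'M[K]_2) (u : K) (r s : rat) B B' D :
  [/\ mvle r P, B = cf r P, mvle s E, D = cf s E & P' = u *: P + E] ->
  s < r -> cindep B D -> vle 0 u -> u 0 != 0 -> \det B = 0 -> B' = u 0 *: B ->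
  (forall X, VALline A1 A2 X <-> pts B B' X \/
     exists alpha Y, unit_lead P P' alpha Y /\ cprop (conevec (ratr alpha) Y) X) ->
  forall X, VALline A1 A2 X <->
    ((exists Y, (exists x c, c ^+ 2 = - u 0 /\ Y = x *: B + c^-1 *: D) /\
       cprop (conevec (ratr s) Y) X) \/
     cone (ratint (ratr s)) (Srestr B B) X) \/ pts B B X.
Proof.
move=> [rP eB sE eD eP'] sr ind vu u0 dB eB' hV X.
have [_ B0] := cline_l ind.
have uP al Y := unit_lead_dep al Y rP eB sE eD eP' sr ind vu u0.
have hc := cone_ratint s X B0 B0 dB dB.
have hp : pts B B' X <-> pts B B X.
  by rewrite /pts /= eB'; have := cprop_scale B X u0; tauto.
split.
  move=> /hV[/hp ?|[al [Y [/uP[[ra [c [c0 hY]]]|[-> hY]] YX]]]]; first by right.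
    by left; right; apply/hc; exists al, Y; split=> //; exists c; split=> //; left.
  by left; left; exists Y.
case=> [[[Y [hY YX]]|/hc[al [Y [ra [c [c0 hY]] YX]]]]|/hp ?]; apply/hV; last by left.
  by right; exists s, Y; split=> //; apply/uP; right.
right; exists al, Y; split=> //; apply/uP; left; split=> //; exists c; split=> //.
by case: hY.
Qed.

End Assembly.

(** * Elimination when the leading matrices are proportional *)

Section Cases.
Variable R : realType.
Local Notation C := (R[i]).
Local Notation K := (puiseuxSeries R).

(* Eliminating one entry in which P does not vanish makes the leading matrix of
   E = P' - u P independent of that of P. *)
Lemma eliminate (P P' : 'M[K]_2) (r : rat) (k : C) :
  [/\ \det P = 0, \det P' = 0 & mpolar P P' = 1] ->
  [/\ mvle r P, mvle r P', cf r P != 0 & k != 0] -> cf r P' = k *: cf r P ->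
  exists (u : K) (s : rat) (E : 'M[K]_2),
    [/\ P' = u *: P + E, vle 0 u, u 0 = k, mvle s E & s < r] /\
    [/\ cindep (cf r P) (cf s E), 0 <= s,
        mpolar (cf r P) (cf s E) = 0 &
        \det (cf s E) = if s == 0 then - k else 0].
Proof.
move=> [dP dP' pol] [rP rP' B0 k0] eB.
have [i [j]] := matrix_entry B0; rewrite mxE => Pij.
have [vi ci] := vle_inv (rP i j) Pij.
pose u := P' i j / P i j; pose E := P' - u *: P.
have vu : vle 0 u by rewrite -(subrr r); apply: vleM.
have uk : u 0 = k.
  rewrite -(subrr r) pcoefM // ci.
  by have /matrixP/(_ i j) := eB; rewrite !mxE => ->; rewrite mulfK.
have eP' : P' = u *: P + E by rewrite /E subrKC.
have Eij : E i j = 0.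
  by rewrite !mxE /u divfK ?subrr //; apply: vle_neq0 Pij.
have polE : mpolar P E = 1.
  have -> : E = 1 *: P' + (- u) *: P by rewrite scale1r scaleNr.
  by rewrite mpolar_linr pol mul1r mpolarxx dP !mulr0 addr0.
have E0 : E != 0.
  by apply: contra_eq_neq polE => ->; rewrite -(scale0r 0) mpolarZr mul0r eq_sym oner_neq0.
(* The determinant of P' = u P + E is u + det E, and P' is singular. *)
have detE : \det E = - u.
  have : \det (u *: P + 1 *: E) = 0 by rewrite scale1r -eP'.
  rewrite det_lin dP polE mulr0 add0r expr1n mul1r !mulr1 => /eqP.
  by rewrite addr_eq0 => /eqP.
have [s [sE D0]] := matrix_lead E0.
have rE : mvle r E.
  by apply: mvleD => // a b q rq; rewrite !mxE pcoefN -[r]add0r in rq *; rewrite (vleM vu (rP a b) rq) oppr0.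
have rE0 : cf r E = 0.
  rewrite /E cfD eB; have -> : cf r (- (u *: P)) = - (k *: cf r P).
    rewrite -uk -cfZ // add0r; apply/matrixP => a b; rewrite !mxE //.
  by rewrite subrr.
have sr : s < r.
  rewrite lt_neqAle; apply/andP; split; first by apply: contraNneq D0 => ->; rewrite rE0.
  by rewrite leNgt; apply: contraNN D0 => /(cf_lt rE) ->.
have [vd cd] := cf_det sE; rewrite detE in vd cd.
(* For s < 0 the series det E = -u would have no constant term, but this term is -k. *)
have s0 : 0 <= s.
  rewrite leNgt; apply/negP => s0; have : (- u) 0 = 0 by apply: vd; lra.
  by rewrite pcoefN uk => /eqP; rewrite oppr_eq0 (negPf k0).
clearbody E u; exists u, s, E; split=> //; split=> //.
- move=> x y e; have x0 : x = 0.
    have /matrixP/(_ i j) := e; rewrite !mxE Eij mulr0 addr0 => /eqP.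
    by rewrite mulf_eq0 (negPf Pij) orbF => /eqP.
  split=> //; move/eqP: e; rewrite x0 scale0r add0r scaler_eq0 (negPf D0) orbF.
  by move/eqP.
(* The series [mpolar P E = 1] has no term at the positive exponent r + s. *)
- have [_ <-] := cf_polar rP sE; rewrite polE pcoef1 //.
  by rewrite gt_eqF // (le_lt_trans s0) // ltrDr (le_lt_trans s0).
- rewrite -cd pcoefN; case: eqVneq => [->|sn]; first by rewrite addr0 uk.
  by rewrite vu ?oppr0 // ltr_wpDl // lt_def sn.
Qed.

Lemma not_cindep_scale (B B' : 'M[C]_2) : B != 0 -> B' != 0 -> ~ cindep B B' ->
  exists k : C, k != 0 /\ B' = k *: B.
Proof.
move=> B0 B'0 h; apply: contrapT => nk; apply: h => l m e.
have m0 : m = 0.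
  apply/eqP; apply: contrapT => /negP m0; apply: nk.
  have e' : B' = (- l / m) *: B.
    apply: (scalerI m0); rewrite scalerA mulrC divfK // scaleNr.
    by apply/eqP; rewrite -addr_eq0 addrC e.
  exists (- l / m); split=> //.
  by apply: contraNneq B'0 => k0; rewrite e' k0 scale0r.
split=> //; move/eqP: e; rewrite m0 scale0r addr0 scaler_eq0 (negPf B0) orbF.
by move/eqP.
Qed.

Lemma set_ext (S T : set 'M[C]_2) : (forall X, S X <-> T X) -> S = T.
Proof. by move=> h; apply/funext => X; apply/propext. Qed.

End Cases.

(** * Classification of the images of lines under VAL *)

Theorem theorem4p2 (R : realType) (A1 A2 : Kmat R) :
  kindep A1 A2 -> meets_Q_in_two A1 A2 ->
  (* (iii) *)
  (exists (r : R) (P1 P2 p q : 'M[R[i]]_2) (s : 'M[R[i]]_2 -> 'M[R[i]]_2),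
     0 < r /\ cindep P1 P2 /\ (forall A, cline P1 P2 A -> \det A = 0) /\
     cline P1 P2 p /\ cline P1 P2 q /\ ~ cprop p q /\
     section s (punct P1 P2 p q) /\
     VALline A1 A2 = cone [set r] (sec_image s (punct P1 P2 p q))
                     `|` cone (ratint r) (Srestr p q) `|` pts p q) \/
  (* (iv) *)
  (exists (P1 P2 p q : 'M[R[i]]_2),
     cindep P1 P2 /\ cline P1 P2 p /\ cline P1 P2 q /\
     \det p = 0 /\ \det q = 0 /\ ~ cprop p q /\
     (forall A, cline P1 P2 A -> \det A = 0 -> cprop p A \/ cprop q A) /\
     VALline A1 A2 = kappa_image (punct P1 P2 p q)
                     `|` cone (ratint 0) (Srestr p q) `|` pts p q) \/
  (* (i) *)
  (exists (r : R) (P1 P2 p : 'M[R[i]]_2) (s : 'M[R[i]]_2 -> 'M[R[i]]_2),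
     0 < r /\ cindep P1 P2 /\ (forall A, cline P1 P2 A -> \det A = 0) /\
     cline P1 P2 p /\
     section s (punct P1 P2 p p) /\
     VALline A1 A2 = cone [set r] (sec_image s (punct P1 P2 p p))
                     `|` cone (ratint r) (Srestr p p) `|` pts p p) \/
  (* (ii) *)
  (exists (P1 P2 p : 'M[R[i]]_2),
     cindep P1 P2 /\ cline P1 P2 p /\ \det p = 0 /\
     (exists A, cline P1 P2 A /\ \det A != 0) /\
     (forall A, cline P1 P2 A -> detpolar p A = 0) /\
     VALline A1 A2 = kappa_image (punct P1 P2 p p)
                     `|` cone (ratint 0) (Srestr p p) `|` pts p p).
Proof.
move=> ind two.
have [P [P' [r [[dP dP' pol] [[rP rP' B0 B'0] hV]]]]] := VALline_unit_lead ind two.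
set B := cf r P in B0 hV; set B' := cf r P' in B'0 hV.
have dB : \det B = 0 by have [_ <-] := cf_det rP; rewrite dP.
have dB' : \det B' = 0 by have [_ <-] := cf_det rP'; rewrite dP'.
have [vpol cpol] := cf_polar rP rP'; rewrite pol -/B -/B' in vpol cpol.
have [indB|/(not_cindep_scale B0 B'0)[k [k0 eB']]] := pselect (cindep B B').
  have VE := VALline_indep (And4 rP rP' erefl erefl) indB dB dB' hV.
  (* The polar form of P and P' has valuation at most 2r and equals 1. *)
  have r0 : 0 <= r.
    rewrite leNgt; apply/negP => r0; have : (1 : puiseuxSeries R) 0 = 0 by apply: vpol; lra.
    by rewrite pcoef10 => /eqP; rewrite oner_eq0.
  move: r0; rewrite le_eqVlt => /predU1P[r0|r0].
    (* Case (iv): for r = 0 the leading matrices still have polar form 1, so the determinant on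
       their line is x y and determinant 1 means y = x^-1. *)
    right; left; exists B, B', B, B'.
    rewrite -r0 addr0 pcoef10 in cpol.
    have dl x y : \det (x *: B + y *: B') = x * y.
      by rewrite det_lin dB dB' -cpol !mulr0 !add0r mulr1.
    split=> //; split; first exact: cline_l.
    split; first exact: cline_r.
    split=> //; split=> //; split; first exact: cindep_nprop.
    split.
      move=> _ [[x [y ->]] M0]; rewrite dl => /eqP; rewrite mulf_eq0 => /orP[]/eqP e; move: M0.
        rewrite e scale0r add0r => M0; right; exists y; split=> //.
        by apply: contraNneq M0 => ->; rewrite scale0r.
      rewrite e scale0r addr0 => M0; left; exists x; split=> //.
      by apply: contraNneq M0 => ->; rewrite scale0r.
    apply: set_ext => X; apply: (iff_trans (VE X)).
    have -> : ratr r = 0 :> R by rewrite -r0 rmorph0.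
    rewrite /setU /=; do 2!apply: or_iff_compat_r.
    split=> [[_ [[c [c0 ->]]]]|[_ [/(punctP _ indB)[x [y [x0 y0 ->]]]]]].
      rewrite conevec0 => YX; exists (c *: B + c^-1 *: B'); split.
        by apply/(punctP _ indB); exists c, c^-1; rewrite invr_eq0.
      by rewrite dl mulfV.
    rewrite dl => -[xy YX]; exists (x *: B + y *: B'); rewrite conevec0; split=> //.
    by exists x; split=> //; congr (_ + _ *: _); apply: (mulfI x0); rewrite xy mulfV.
  (* Case (iii): for r > 0 the polar form of the leading matrices is the coefficient of 1 at 2r,
     hence 0, and their line lies in the quadric. *)
  left; have [a [b [aB aB' bB bB']]] := dual_forms indB.
  have rr : r + r != 0 by rewrite gt_eqF // addr_gt0.
  have pB : mpolar B B' = 0 by rewrite -cpol pcoef1.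
  exists (ratr r), B, B', B, B', (normalize a b).
  split; first by rewrite ltr0q.
  split=> //; split; first exact: det_cline0.
  split; first exact: cline_l.
  split; first exact: cline_r.
  split; first exact: cindep_nprop.
  split.
    apply: section_normalize => M /[dup] hM /(punctP _ indB)[x [y [x0 y0 eM]]].
    have [lM _] := hM; split; first by have [] := lM.
      exact: (det_cline0 dB dB' pB lM).
    by rewrite eM !lformD !lformZ aB aB' bB bB' !mulr0 !mulr1 addr0 add0r mulf_neq0.
  apply: set_ext => X; apply: (iff_trans (VE X)).
  rewrite /setU /=; do 2!apply: or_iff_compat_r; apply: iff_sym; exact: cone_section_iii.
have [u [s [E [[eP' vu uk sE sr] [indD s0 pD dD]]]]] :=
  eliminate (And3 dP dP' pol) (And4 rP rP' B0 k0) eB'.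
set D := cf s E in indD pD dD.
have u0 : u 0 != 0 by rewrite uk.
have eB'' : B' = u 0 *: B by rewrite uk.
have VE := VALline_dep (And5 rP erefl sE erefl eP') sr indD vu u0 dB eB'' hV.
rewrite uk in VE.
move: s0; rewrite le_eqVlt => /predU1P[s0|s0].
  (* Case (ii): for s = 0 the determinant on the line is -k y^2, so the line is tangent at [B], and
     determinant 1 means y = c^-1 with c^2 = -k. *)
  right; right; right; exists B, D, B.
  rewrite -s0 eqxx in dD.
  have dl x y : \det (x *: B + y *: D) = - k * y ^+ 2.
    by rewrite det_lin dB dD pD !mulr0 addr0 add0r mulrC.
  split=> //; split; first exact: cline_l.
  split=> //; split; first by exists D; split; [exact: cline_r | rewrite dD oppr_eq0].
  split.
    move=> _ [[x [y ->]] _]; rewrite /detpolar -mpolarE mpolar_linr mpolarxx dB pD.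
    by rewrite !mulr0 addr0.
  apply: set_ext => X; apply: (iff_trans (VE X)).
    have -> : ratr s = 0 :> R by rewrite -s0 rmorph0.
  rewrite /setU /=; do 2!apply: or_iff_compat_r.
  split=> [[_ [[x [c [ck ->]]]]]|[_ [/(punct1P _ indD)[x [y [y0 ->]]]]]].
    have c0 : c != 0 by rewrite -sqrf_eq0 ck oppr_eq0.
    rewrite conevec0 => YX; exists (x *: B + c^-1 *: D); split.
      by apply/(punct1P _ indD); exists x, c^-1; rewrite invr_eq0.
    by rewrite dl -ck exprVn mulfV // expf_neq0.
  rewrite dl => -[ky YX]; exists (x *: B + y *: D); rewrite conevec0; split=> //.
  exists x, y^-1; rewrite invrK; split=> //.
  by apply: (mulIf (expf_neq0 2 y0)); rewrite ky exprVn mulVf // expf_neq0.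
(* Case (i): for s > 0 also [D] is singular, so the line through [B] and [D] lies in the quadric. *)
right; right; left; have [_ [b [_ _ bB bD]]] := dual_forms indD.
rewrite gt_eqF // in dD.
exists (ratr s), B, D, B, (normalize ((- k) *: b) b).
split; first by rewrite ltr0q.
split=> //; split; first exact: det_cline0.
split; first exact: cline_l.
split.
  apply: section_normalize => M /[dup] hM /(punct1P _ indD)[x [y [y0 eM]]].
  have [lM _] := hM; split; first by have [] := lM.
    exact: (det_cline0 dB dD pD lM).
  rewrite eM lformZl lformD !lformZ bB bD mulr0 mulr1 add0r.
  by rewrite !mulf_neq0 ?oppr_eq0.
apply: set_ext => X; apply: (iff_trans (VE X)).
rewrite /setU /=; do 2!apply: or_iff_compat_r; apply: iff_sym; exact: cone_section_i.
Qed.
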